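(* Two simple graphs $G$ and $H$ satisfy $G \simeq_1^{\mathrm{L}} H$ if and only if $G \equiv_{\mathcal{OP}} H$, where $\mathcal{OP}$ denotes the class of outerplanar graphs.
   Context: Graphs are finite, undirected, and without multiple edges; simple means without loops. A graph is outerplanar if it does not have $K_4$ or $K_{2,3}$ as a minor (equivalently, it has a planar drawing with all vertices on a common face). For graphs $F,G$, $\hom(F,G)$ is the number of homomorphisms from $F$ to $G$. For a class $\mathcal{F}$ of graphs, $G\equiv_{\mathcal{F}} H$ means $\hom(F,G)=\hom(F,H)$ for all $F\in\mathcal{F}$. For a set $X$ and $k \in \mathbb{N}$, $\binom{X}{\leq k}$ is the set of subsets of $X$ of size at most $k$. An element $(g,h) \in V(G)\times V(H)$ is written $gh$. A set $\{g_1h_1,\dots,g_\ell h_\ell\} \subseteq V(G)\times V(H)$ is a partial isomorphism if for all $i,j\in[\ell]$: $g_i=g_j \Leftrightarrow h_i=h_j$, and $g_ig_j\in E(G) \Leftrightarrow h_ih_j \in E(H)$. $G \simeq_1^{\mathrm{L}} H$ means that the following system (the level-$1$ Lasserre relaxation for graph isomorphism) in real variables $y_I$, $I \in \binom{V(G)\times V(H)}{\leq 2}$, is feasible: (i) the matrix $(y_{I\cup J})_{I,J\in\binom{V(G)\times V(H)}{\leq 1}}$ is positive semidefinite; (ii) $\sum_{h\in V(H)} y_{\{gh\}} = y_\emptyset$ for all $g\in V(G)$; (iii) $\sum_{g\in V(G)} y_{\{gh\}} = y_\emptyset$ for all $h\in V(H)$; (iv) $y_I=0$ for every $I\in\binom{V(G)\times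 V(H)}{\leq 2}$ that is not a partial isomorphism; (v) $y_\emptyset=1$. *)

(* Defs.v *)
From mathcomp Require Import all_boot all_order all_algebra.
From mathcomp Require Import reals.
Set Implicit Arguments.
Unset Strict Implicit.
Unset Printing Implicit Defensive.
Import Order.TTheory GRing.Theory Num.Theory.

(* Loops are allowed in a [graph] and excluded in an [sgraph]. *)
Record graph := Graph {
  vertex :> finType;
  edge : rel vertex;
  edge_sym : symmetric edge
}.

Record sgraph := SGraph {
  sgraph_graph :> graph;
  edge_irrefl : irreflexive (@edge sgraph_graph)
}.

Lemma complete_sym n : symmetric [rel i j : 'I_n | i != j].
Proof. by move=> i j /=; rewrite eq_sym. Qed.

Lemma complete_irrefl n : irreflexive [rel i j : 'I_n | i != j].
Proof. by move=> i /=; rewrite eqxx. Qed.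

Definition complete (n : nat) : sgraph :=
  @SGraph (Graph (@complete_sym n)) (@complete_irrefl n).

Definition bipartite_edge (m n : nat) : rel ('I_m + 'I_n)%type :=
  fun u v => match u, v with
             | inl _, inr _ | inr _, inl _ => true
             | _, _ => false
             end.

Lemma bipartite_sym m n : symmetric (@bipartite_edge m n).
Proof. by move=> [i|i] [j|j]. Qed.

Lemma bipartite_irrefl m n : irreflexive (@bipartite_edge m n).
Proof. by move=> [i|i]. Qed.

Definition complete_bipartite (m n : nat) : sgraph :=
  @SGraph (Graph (@bipartite_sym m n)) (@bipartite_irrefl m n).

Definition connected_set (F : graph) (B : {set F}) : Prop :=
  forall x y, x \in B -> y \in B ->
    connect [rel u v | [&& u \in B, v \in B & edge u v]] x y.

(* [M] arises from [F] by deletions and contractions: [phi u] is the set of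
   vertices of [F] that are contracted to the vertex [u].  [M] is loopless
   because loops of a minor are not tracked by branch sets. *)
Definition minor (M : sgraph) (F : graph) : Prop :=
  exists phi : M -> {set F},
    [/\ forall u, phi u != set0,
        forall u, connected_set (phi u),
        forall u v, u != v -> [disjoint phi u & phi v]
      & forall u v, edge u v ->
          exists x y, [/\ x \in phi u, y \in phi v & edge x y]].

Definition outerplanar (F : graph) : Prop :=
  ~ minor (complete 4) F /\ ~ minor (complete_bipartite 2 3) F.

Definition is_hom (F G : graph) (f : {ffun F -> G}) : bool :=
  [forall x, forall y, edge x y ==> edge (f x) (f y)].

Definition hom (F G : graph) : nat := #|[set f | @is_hom F G f]|.

Definition hom_equiv (C : graph -> Prop) (G H : graph) : Prop :=
  forall F : graph, C F -> hom F G = hom F H.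

Definition subsets_le (T : finType) (k : nat) : {set {set T}} :=
  [set I : {set T} | #|I| <= k].

Definition partial_iso (G H : graph) (I : {set G * H}) : bool :=
  [forall p in I, forall q in I,
     ((p.1 == q.1) == (p.2 == q.2)) && (edge p.1 q.1 == edge p.2 q.2)].

Local Open Scope ring_scope.

Definition psdmx (R : realType) (n : nat) (A : 'M[R]_n) : Prop :=
  A^T = A /\ forall v : 'rV[R]_n, 0 <= (v *m A *m v^T) 0 0.

(* Rows and columns are indexed by the enumeration of [subsets_le T k]. *)
Definition moment_mx (R : realType) (T : finType) (k : nat)
    (y : {set T} -> R) : 'M[R]_#|subsets_le T k| :=
  \matrix_(i, j) y (enum_val i :|: enum_val j).

(* [y] is a total function on sets of pairs, but the constraints only involve
   its values on sets of size at most 2. *)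
Record lasserre1_solution (R : realType) (G H : graph)
    (y : {set G * H} -> R) : Prop := {
  lasserre1_psd : psdmx (moment_mx 1 y);
  lasserre1_row : forall g : G, \sum_(h : H) y [set (g, h)] = y set0;
  lasserre1_col : forall h : H, \sum_(g : G) y [set (g, h)] = y set0;
  lasserre1_iso : forall I : {set G * H},
    I \in subsets_le _ 2 -> ~~ partial_iso I -> y I = 0;
  lasserre1_norm : y set0 = 1
}.

Definition lasserre1 (R : realType) (G H : graph) : Prop :=
  exists y : {set G * H} -> R, lasserre1_solution y.

(* Main.v *)
(* Call a word any term built from the all-ones matrix by matrix products and by
   Schur products with the identity and with the adjacency matrix; it denotes a
   matrix over every graph. Both sides of the theorem say that, for every word,
   the matrices over [G] and over [H] have the same sum of entries.

   The sum of entries of a word counts homomorphisms from a graph that has a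
   vertex order without crossing edges, hence is outerplanar. Conversely, let
   [u, v] be vertices of a graph that stays outerplanar when a path of length 2
   is attached to them. If the graph without the edge [uv] had two disjoint
   [u]-[v] paths, there would be a [K_(2,3)]; so by Menger a vertex separates
   [u] from [v], and the matrix of homomorphism counts with prescribed images of
   [u] and [v] is a product of two smaller ones.

   A Lasserre solution is the Choi matrix of a completely positive, unital and
   trace preserving map. Such a map intertwines every pair of matrices that it
   exchanges with its adjoint; these pairs are closed under products, hence
   contain all words. Conversely, equal sums make the span of the pairs
   (word over [G], word over [H]) the graph of a trace preserving algebra
   isomorphism, and [\sum_i B_i (x) C_i], for an orthonormal basis [(B_i, C_i)]
   of this span, is a Lasserre solution. *)
Require Import Defs.
From mathcomp Require Import all_boot all_order all_algebra.
From mathcomp Require Import reals.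
From mathcomp Require boolp.
From mathcomp Require Import zify ring lra.
(* [hom] is also the name of a constant of [vector]. *)
Import Defs.

Set Implicit Arguments.
Unset Strict Implicit.
Unset Printing Implicit Defensive.

(** * Connected sets and minors *)

(** The decomposition into words has to start somewhere: if deleting a vertex [u] leaves a connected
    graph, some neighbour [w] of [u] can be deleted as well without disconnecting the other
    neighbours of [u] from each other. Then [u w] behaves like an edge of the outer face, since two
    disjoint connections besides it would complete a [K_4]. The property also has to survive the
    splitting at a separating vertex [c]: the far side, contracted onto [c], takes over the role of
    the path of length 2 attached outside. For the completely positive map, pairs of matrices that
    are mapped in one direction only need not be closed under products. Exchange in both directions
    gives the two matrices the same norm, and this equality forces the intertwining relation. In the
    converse, let [P] be the sum of the [B_i (x) C_i]. Multiplying [P] by [B_i] over [G] has the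
    same effect as multiplying it by the transpose of [C_i] over [H]. Hence [P P = c P], where [c]
    is the sum of the [1 (x) C_i C_i^T]; it is positive definite because the identity is a
    combination of the [C_i], and positivity of [P] follows. *)

Section Connectivity.
Variable V : finType.
Implicit Types (r : rel V) (B S K : {set V}).

Definition restr r S : rel V := [rel u v | [&& u \in S, v \in S & r u v]].

Definition conn r B : Prop :=
  forall x y, x \in B -> y \in B -> connect (restr r B) x y.

Lemma restr_sym r S : symmetric r -> symmetric (restr r S).
Proof. by move=> rs x y; rewrite /restr /= rs andbCA. Qed.

Lemma connect_restr_sub r1 r2 B1 B2 x y :
  {in B1 &, subrel r1 r2} -> B1 \subset B2 ->
  connect (restr r1 B1) x y -> connect (restr r2 B2) x y.
Proof.
move=> r12 sB; apply: connect_sub => {x y} x y /and3P[xB yB rxy].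
by apply: connect1; rewrite /restr /= !(subsetP sB) //= r12.
Qed.

Lemma connect_restr_mem r S x y : x \in S -> connect (restr r S) x y -> y \in S.
Proof.
move=> xS /connectP[p rp ->]; elim: p x xS rp => //= z p IH x xS.
by case/andP=> /and3P[_ zS _]; apply: IH.
Qed.

Lemma connect_cut r S (P : pred V) x y :
  connect (restr r S) x y -> P x -> ~~ P y ->
  exists a b, [/\ a \in S, b \in S, P a, ~~ P b & r a b].
Proof.
case/connectP=> p rp ->; elim: p x rp => [|z p IH] x /=; first by move=> _ ->.
case/andP=> /and3P[xS zS rxz] rp Px Py.
by have [Pz|nPz] := boolP (P z); [exact: IH rp Pz Py | exists x, z].
Qed.

Lemma conn_cut r B (P : pred V) x y :
  conn r B -> x \in B -> y \in B -> P x -> ~~ P y ->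
  exists a b, [/\ a \in B, b \in B, P a, ~~ P b & r a b].
Proof. by move=> cB xB yB; apply: connect_cut; apply: cB. Qed.

Lemma conn1 r x : conn r [set x].
Proof. by move=> a b /set1P-> /set1P->. Qed.

Lemma conn_sub_rel r1 r2 B : {in B &, subrel r1 r2} -> conn r1 B -> conn r2 B.
Proof. by move=> r12 cB x y xB yB; apply: connect_restr_sub (cB x y xB yB). Qed.

Lemma connU r B1 B2 x y : symmetric r -> conn r B1 -> conn r B2 ->
  x \in B1 -> y \in B2 -> (x == y) || r x y -> conn r (B1 :|: B2).
Proof.
move=> rs c1 c2 x1 y2 rxy.
have cs : connect_sym (restr r (B1 :|: B2)).
  exact/sym_connect_sym/restr_sym.
have cx z : z \in B1 :|: B2 -> connect (restr r (B1 :|: B2)) x z.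
  case/setUP=> [z1|z2].
    by apply: connect_restr_sub (c1 x z x1 z1) => //; apply: subsetUl.
  apply: (@connect_trans _ _ y).
    case/orP: rxy => [/eqP->//|rxy]; apply: connect1.
    by rewrite /restr /= !inE x1 y2 rxy orbT.
  by apply: connect_restr_sub (c2 y z y2 z2) => //; apply: subsetUr.
by move=> a b aB bB; apply: connect_trans (cx b bB); rewrite cs; apply: cx.
Qed.

Definition component r S x : {set V} := [set y | connect (restr r S) x y].

Lemma mem_component r S x : x \in component r S x.
Proof. by rewrite inE. Qed.

Lemma component_sub r S x : x \in S -> component r S x \subset S.
Proof. by move=> xS; apply/subsetP=> y; rewrite inE; apply: connect_restr_mem. Qed.

Lemma component_closed r S x y z : x \in S ->
  y \in component r S x -> z \in S -> r y z -> z \in component r S x.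
Proof.
move=> xS yc zS ryz; have yS := subsetP (component_sub r xS) y yc.
move: yc; rewrite !inE => yc; apply: connect_trans yc _.
by apply: connect1; rewrite /restr /= yS zS.
Qed.

Lemma conn_component r S x : symmetric r -> x \in S -> conn r (component r S x).
Proof.
move=> rs xS.
have cs := sym_connect_sym (@restr_sym r (component r S x) rs).
have cx z : z \in component r S x -> connect (restr r (component r S x)) x z.
  move=> zc; apply/negPn/negP=> ncz; have:= zc; rewrite inE => xz.
  have [a [b []]] := @connect_cut r S
     [pred t | connect (restr r (component r S x)) x t] x z xz (connect0 _ _) ncz.
  move=> aS bS /= xa nxb rab; case/negP: nxb; apply: (connect_trans xa).
  have ac : a \in component r S x by apply: connect_restr_mem xa; apply: mem_component.
  by apply: connect1; rewrite /restr /= ac (component_closed xS ac).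
by move=> a b ac bc; apply: connect_trans (cx b bc); rewrite cs; apply: cx.
Qed.

Lemma conn_sub_component r S B x : conn r B -> B \subset S -> x \in B ->
  B \subset component r S x.
Proof.
move=> cB BS xB; apply/subsetP=> y yB; rewrite inE.
by apply: connect_restr_sub (cB x y xB yB).
Qed.

End Connectivity.

Section MinorIn.
Variables (M : sgraph) (V : finType).
Implicit Types (r : rel V) (S : {set V}).

(** Minors of the subgraph of [r] induced by [S]. Keeping [V] fixed and varying [r] and [S] allows
    edges to be added and vertices to be deleted without new vertex types. *)
Definition minor_in r S : Prop :=
  exists phi : M -> {set V},
    [/\ forall u, phi u != set0,
        forall u, phi u \subset S,
        forall u, conn r (phi u),
        forall u v, u != v -> [disjoint phi u & phi v]
      & forall u v, edge u v -> exists x y, [/\ x \in phi u, y \in phi v & r x y]].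

Lemma minor_in_sub r1 r2 S1 S2 : {in S1 &, subrel r1 r2} -> S1 \subset S2 ->
  minor_in r1 S1 -> minor_in r2 S2.
Proof.
move=> r12 sS [phi [ne sub c d a]]; exists phi; split=> // u.
- exact: subset_trans (sub u) sS.
- apply: conn_sub_rel (c u) => x y xu yu.
  by apply: r12; apply: (subsetP (sub u)).
move=> v /a[x [y [xu yv rxy]]]; exists x, y; split=> //.
by apply: r12 rxy; [apply: (subsetP (sub u)) | apply: (subsetP (sub v))].
Qed.

End MinorIn.

Lemma minorE (M : sgraph) (F : graph) : minor M F <-> minor_in M (@edge F) setT.
Proof.
split=> [[phi [ne c d a]]|[phi [ne _ c d a]]]; exists phi; split=> //.
Qed.

(* A chord separates the circle, so two disjoint connected sets cannot
   interleave; any order of the branch sets of [K_4] or [K_(2,3)] does so. *)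
Section Noncrossing.
Variables (V : finType) (pos : V -> nat) (r : rel V).
Hypothesis pos_inj : injective pos.
Hypothesis r_sym : symmetric r.
Hypothesis noncross : forall x y z t, r x z -> r y t ->
  ~ [/\ pos x < pos y, pos y < pos z & pos z < pos t].

Lemma pos_neq (B1 B2 : {set V}) x y :
  [disjoint B1 & B2] -> x \in B1 -> y \in B2 -> pos x <> pos y.
Proof.
by move=> d x1 y2 /pos_inj exy; rewrite exy (disjointFl d) in x1.
Qed.

Lemma not_between a b y :
  ~~ ((a < y) && (y < b)) -> y <> a -> y <> b -> y < a \/ b < y.
Proof.
by case: (ltngtP a y) => [|ya|->] // _; case: (ltngtP y b) => [|yb|->] // _ _; [right | left..].
Qed.

Lemma no_interleaving_ordered (B1 B2 : {set V}) a b c d :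
  conn r B1 -> conn r B2 -> [disjoint B1 & B2] ->
  a \in B1 -> c \in B1 -> b \in B2 -> d \in B2 ->
  ~ [/\ pos a < pos b, pos b < pos c & pos c < pos d].
Proof.
move=> c1 c2 dis a1 c1' b2 d2 [ab bc cd].
(* [B1] contains an edge with one end [x] strictly between [b] and [d] and the other end [y]
   outside. As a chord it separates [b] from [d], so some edge of [B2] has to cross it. *)
have [] := @conn_cut _ r B1 [pred x | (pos b < pos x) && (pos x < pos d)] c a c1 c1' a1.
- by rewrite /= bc cd.
- by rewrite /= negb_and -!leqNgt (ltnW ab).
move=> x [y [x1 y1 /andP[/= bx xd] ny rxy]].
have yb := pos_neq dis y1 b2; have yd := pos_neq dis y1 d2.
have ryx : r y x by rewrite r_sym.
have [lyb|lyd] : pos y < pos b \/ pos d < pos y by apply: not_between.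
- have [] := @conn_cut _ r B2 [pred z | (pos y < pos z) && (pos z < pos x)] b d c2 b2 d2.
  + by rewrite /= lyb bx.
  + by rewrite /= negb_and -!leqNgt (ltnW xd) orbT.
  move=> z [t [z2 t2 /andP[/= yz zx] nt rzt]].
  have xt := pos_neq dis x1 t2; have yt := pos_neq dis y1 t2.
  have [tylt|txlt] : pos t < pos y \/ pos x < pos t by apply: not_between => // /esym.
  + by apply: (noncross (x := t) (z := z) (y := y) (t := x)); rewrite // r_sym.
  + exact: (noncross ryx rzt).
- have [] := @conn_cut _ r B2 [pred z | (pos x < pos z) && (pos z < pos y)] d b c2 d2 b2.
  + by rewrite /= lyd xd.
  + by rewrite /= negb_and -!leqNgt (ltnW bx).
  move=> z [t [z2 t2 /andP[/= xz zy] nt rzt]].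
  have xt := pos_neq dis x1 t2; have yt := pos_neq dis y1 t2.
  have [txlt|tylt] : pos t < pos x \/ pos y < pos t by apply: not_between => // /esym.
  + by apply: (noncross (x := t) (z := z) (y := x) (t := y)); rewrite // r_sym.
  + exact: (noncross rxy rzt).
Qed.

Definition between (a b c : nat) := (a < b /\ b < c) \/ (c < b /\ b < a).

Lemma no_interleaving (B1 B2 : {set V}) a b c d :
  conn r B1 -> conn r B2 -> [disjoint B1 & B2] ->
  a \in B1 -> c \in B1 -> b \in B2 -> d \in B2 ->
  between (pos a) (pos b) (pos c) -> between (pos a) (pos d) (pos c).
Proof.
move=> c1 c2 dis a1 c1' b2 d2 ibt.
have ad := pos_neq dis a1 d2; have cd := pos_neq dis c1' d2.
have ds : [disjoint B2 & B1] by rewrite disjoint_sym.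
have I := no_interleaving_ordered c1 c2 dis.
have J := no_interleaving_ordered c2 c1 ds.
have I1 := I a b c d; have I2 := I c b a d.
have J1 := J d a b c; have J2 := J d c b a.
rewrite /between in ibt *.
case: (ltngtP (pos a) (pos d)) => // H1; case: (ltngtP (pos d) (pos c)) => // [H2|H2|/esym//];
  case: ibt => [[H3 H4]|[H3 H4]]; try by [left | right].
- by case: I1.
- by case: I2.
- by case: J1.
- by case: J2.
Qed.

Lemma connU_branch (M : sgraph) (phi : M -> {set V}) u v :
  (forall u, conn r (phi u)) ->
  (forall u v, edge u v -> exists x y, [/\ x \in phi u, y \in phi v & r x y]) ->
  edge u v -> conn r (phi u :|: phi v).
Proof.
move=> c a /a[x [y [xu yv rxy]]].
by apply: (connU r_sym (c u) (c v) xu yv); rewrite rxy orbT.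
Qed.

Lemma disjointUU (A B C D : {set V}) :
  [disjoint A & C] -> [disjoint A & D] -> [disjoint B & C] -> [disjoint B & D] ->
  [disjoint A :|: B & C :|: D].
Proof.
rewrite -!setI_eq0 setIUl !setIUr => /eqP-> /eqP-> /eqP-> /eqP->.
by rewrite !setU0.
Qed.

(** An edge of [M] makes the union of its two branch sets connected, and two edges without a common
    vertex give disjoint unions. So the chords between representatives of their ends do not
    cross. *)
Lemma noncrossing_minor_pairs (M : sgraph) (phi : M -> {set V}) (x : M -> V)
    (i j k l : M) :
  (forall u, x u \in phi u) ->
  (forall u, conn r (phi u)) ->
  (forall u v, u != v -> [disjoint phi u & phi v]) ->
  (forall u v, edge u v -> exists x y, [/\ x \in phi u, y \in phi v & r x y]) ->
  edge i j -> edge k l -> i != k -> i != l -> j != k -> j != l ->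
  between (pos (x i)) (pos (x k)) (pos (x j)) ->
  between (pos (x i)) (pos (x l)) (pos (x j)).
Proof.
move=> xP c d a ij kl ik il jk jl.
apply: (@no_interleaving (phi i :|: phi j) (phi k :|: phi l)).
- exact: connU_branch.
- exact: connU_branch.
- by apply: disjointUU; apply: d.
all: by rewrite inE xP ?orbT.
Qed.

(** However four points lie on a circle, one of the three ways to pair them up consists of crossing
    chords, and in [K_4] each pairing consists of edges. *)
Lemma noncrossing_no_K4 (S : {set V}) : ~ minor_in (complete 4) r S.
Proof.
case=> phi [ne _ c d a].
have xP u : {x | x \in phi u} by apply/sigW/set0Pn.
pose x u := sval (xP u).
have D u v : u != v -> pos (x u) <> pos (x v).
  by move=> uv; apply: pos_neq (d u v uv) (svalP (xP u)) (svalP (xP v)).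
have B i j k l := @noncrossing_minor_pairs _ phi x i j k l (fun u => svalP (xP u)) c d a.
pose o (i : nat) (H : i < 4) : complete 4 := Ordinal H.
pose i0 := @o 0 isT; pose i1 := @o 1 isT; pose i2 := @o 2 isT; pose i3 := @o 3 isT.
have D01 := D i0 i1 isT; have D02 := D i0 i2 isT; have D03 := D i0 i3 isT.
have D12 := D i1 i2 isT; have D13 := D i1 i3 isT; have D23 := D i2 i3 isT.
have B1 := B i0 i1 i2 i3 isT isT isT isT isT isT.
have B2 := B i0 i1 i3 i2 isT isT isT isT isT isT.
have B3 := B i0 i2 i1 i3 isT isT isT isT isT isT.
have B4 := B i0 i2 i3 i1 isT isT isT isT isT isT.
have B5 := B i0 i3 i2 i1 isT isT isT isT isT isT.
have B6 := B i0 i3 i1 i2 isT isT isT isT isT isT.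
rewrite /between in B1 B2 B3 B4 B5 B6; lia.
Qed.

(** The representatives of [p] and [q] cut the circle into two arcs, and two of the other three
    representatives, of [y] and [z], share an arc ([K] and [K'] treat the two arcs). Then [p y],
    [q z] or [p z], [q y] is a crossing pair of chords. *)
Lemma noncrossing_no_K23 (S : {set V}) : ~ minor_in (complete_bipartite 2 3) r S.
Proof.
case=> phi [ne _ c d a].
have xP u : {x | x \in phi u} by apply/sigW/set0Pn.
pose x u := sval (xP u).
have D u v : u != v -> pos (x u) <> pos (x v).
  by move=> uv; apply: pos_neq (d u v uv) (svalP (xP u)) (svalP (xP v)).
have B i j k l := @noncrossing_minor_pairs _ phi x i j k l (fun u => svalP (xP u)) c d a.
pose p : complete_bipartite 2 3 := inl (Ordinal (isT : 0 < 2)).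
pose q : complete_bipartite 2 3 := inl (Ordinal (isT : 1 < 2)).
pose o (i : nat) (H : i < 3) : complete_bipartite 2 3 := inr (Ordinal H).
have Dpq := D p q isT.
pose R y := [/\ edge p y, edge y q, p != y & y != q].
have K y z : y != z -> R y -> R z ->
    between (pos (x p)) (pos (x y)) (pos (x q)) ->
    between (pos (x p)) (pos (x z)) (pos (x q)) -> False.
  move=> yz [py yq npy nyq] [pz zq npz nzq].
  have zy : z != y by rewrite eq_sym.
  move: (D y z yz) (B p y z q py zq npz isT yz nyq) (B p z y q pz yq npy isT zy nzq).
  rewrite /between; clear; lia.
have K' y z : y != z -> R y -> R z ->
    ~ between (pos (x p)) (pos (x y)) (pos (x q)) ->
    ~ between (pos (x p)) (pos (x z)) (pos (x q)) -> False.
  move=> yz [py yq npy nyq] [pz zq npz nzq].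
  have zy : z != y by rewrite eq_sym.
  have qy : edge q y by rewrite edge_sym.
  have qz : edge q z by rewrite edge_sym.
  have nqy : q != y by rewrite eq_sym.
  have nqz : q != z by rewrite eq_sym.
  move: (D y z yz) (D p y npy) (D p z npz) (D y q nyq) (D z q nzq).
  move: (B p y q z py qz isT npz nyq yz) (B p z q y pz qy isT npy nzq zy).
  move: (B p y z q py zq npz isT yz nyq) (B p z y q pz yq npy isT zy nzq).
  rewrite /between; move: Dpq; clear; lia.
pose y0 := @o 0 isT; pose y1 := @o 1 isT; pose y2 := @o 2 isT.
have E i H : R (@o i H) by split.
have K01 := K y0 y1 isT (E _ _) (E _ _); have K02 := K y0 y2 isT (E _ _) (E _ _).
have K12 := K y1 y2 isT (E _ _) (E _ _).
have L01 := K' y0 y1 isT (E _ _) (E _ _); have L02 := K' y0 y2 isT (E _ _) (E _ _).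
have L12 := K' y1 y2 isT (E _ _) (E _ _).
rewrite /between in K01 K02 K12 L01 L02 L12; move: K01 K02 K12 L01 L02 L12; clear; lia.
Qed.

End Noncrossing.

(** * Words and the graphs that they count *)

Section Quotient.
Variables (T : finType) (eqv adj : rel T).
Hypothesis eqv_sym : symmetric eqv.
Hypothesis adj_sym : symmetric adj.

Let csym : connect_sym eqv := sym_connect_sym eqv_sym.

(** The classes are those of the equivalence closure of [eqv], each represented by its root; [eqv]
    itself is only a symmetric set of equality edges. *)
Definition quot_vertex : finType := {x : T | fingraph.root eqv x == x}.

Definition quot_class (x : T) : quot_vertex :=
  exist (fun x => fingraph.root eqv x == x) (fingraph.root eqv x) (introT eqP (root_root csym x)).

Definition quot_edge : rel quot_vertex := fun u v =>
  [exists x, exists y, [&& quot_class x == u, quot_class y == v & adj x y]].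

Lemma quot_edge_sym : symmetric quot_edge.
Proof.
move=> u v; apply/existsP/existsP => -[x /existsP[y /and3P[xu yv xy]]];
  by exists y; apply/existsP; exists x; rewrite xu yv adj_sym.
Qed.

Definition quotient : graph := Graph quot_edge_sym.

Lemma quot_classK (u : quot_vertex) : quot_class (val u) = u.
Proof. by apply: val_inj => /=; apply/eqP; apply: (valP u). Qed.

Lemma quot_class_eqP x y : reflect (quot_class x = quot_class y) (connect eqv x y).
Proof.
by rewrite -(root_connect csym); apply: (iffP eqP) => [H|[]//]; apply: val_inj.
Qed.

Definition respects (G : graph) (f : {ffun T -> G}) : bool :=
  [forall x, forall y, (adj x y ==> edge (f x) (f y)) && (eqv x y ==> (f x == f y))].

Lemma respects_class (G : graph) (f : {ffun T -> G}) x y :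
  respects f -> connect eqv x y -> f x = f y.
Proof.
move=> rf /connectP[p ep ->]; elim: p x ep => //= z p IH x /andP[xz /IH <-].
by have /forallP/(_ x)/forallP/(_ z)/andP[_ /implyP/(_ xz)/eqP] := rf.
Qed.

Lemma hom_quotient (G : graph) :
  hom quotient G = #|[set f : {ffun T -> G} | respects f]|.
Proof.
pose h (f : {ffun quotient -> G}) : {ffun T -> G} := [ffun x => f (quot_class x)].
have hinj : injective h.
  move=> f g /ffunP hfg; apply/ffunP=> u.
  by have := hfg (val u); rewrite !ffunE quot_classK.
rewrite /hom -(card_imset _ hinj); congr #|pred_of_set _|; apply/setP=> f.
rewrite inE; apply/imsetP/idP => [[g]|rf].
- rewrite inE => /forallP hg ->; apply/forallP=> x; apply/forallP=> y.
  rewrite !ffunE; apply/andP; split; apply/implyP=> xy.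
    have /forallP/(_ (quot_class y))/implyP := hg (quot_class x); apply.
    by apply/existsP; exists x; apply/existsP; exists y; rewrite !eqxx.
  by apply/eqP; congr (g _); apply/quot_class_eqP; apply: connect1.
- exists [ffun u : quotient => f (val u)]; last first.
    by apply/ffunP=> x; rewrite !ffunE; apply: respects_class rf (connect_root _ _).
  rewrite inE; apply/forallP=> u; apply/forallP=> v; apply/implyP.
  case/existsP=> x /existsP[y /and3P[/eqP<- /eqP<- xy]]; rewrite !ffunE /=.
  rewrite -!(respects_class rf (connect_root _ _)).
  by have /forallP/(_ x)/forallP/(_ y)/andP[/implyP/(_ xy)] := rf.
Qed.

(** Preimages of branch sets under the class map are again branch sets: a path along [eqv] stays in
    one class, hence in one preimage. So minors can be excluded before the equality edges are
    contracted, where the vertex order is at hand. *)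
Lemma minor_quotient (M : sgraph) :
  minor M quotient -> minor_in M (relU adj eqv) setT.
Proof.
move/minorE=> [phi [ne _ c d a]].
pose psi u := [set x | quot_class x \in phi u].
have rs : symmetric (relU adj eqv) by move=> x y /=; rewrite adj_sym eqv_sym.
have psi_eqv u x y : x \in psi u -> connect eqv x y ->
    connect (restr (relU adj eqv) (psi u)) x y.
  move=> xu /connectP[p ep ->]; elim: p x xu ep => //= z p IH x xu /andP[xz ep].
  have zu : z \in psi u.
    by move: xu; rewrite !inE (quot_class_eqP x z (connect1 xz)).
  by apply: connect_trans (IH z zu ep); apply: connect1; rewrite /restr /= xu zu xz orbT.
exists psi; split=> //.
- move=> u; have /set0Pn[q qu] := ne u.
  by apply/set0Pn; exists (val q); rewrite inE quot_classK.
- move=> u x y xu yu.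
  have /connectP[p ep] : connect (restr (@edge quotient) (phi u)) (quot_class x) (quot_class y).
    by rewrite !inE in xu yu; apply: (c u _ _ xu yu).
  elim: p x xu ep => [|q p IH] x xu /=.
    by move=> _ /esym/quot_class_eqP; apply: psi_eqv.
  case/andP=> /and3P[_ qu /existsP[x' /existsP[y' /and3P[/eqP xx' /eqP qy' x'y']]]] ep el.
  have y'u : y' \in psi u by rewrite inE qy'.
  have x'u : x' \in psi u by move: xu; rewrite !inE xx'.
  apply: (@connect_trans _ _ x').
    by apply: psi_eqv => //; apply/quot_class_eqP.
  apply: (@connect_trans _ _ y').
    by apply: connect1; rewrite /restr /= x'u y'u x'y'.
  by apply: IH => //; rewrite qy'.
- move=> u v /d/disjoint_setI0/setP duv; rewrite -setI_eq0; apply/eqP/setP=> x.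
  by have := duv (quot_class x); rewrite !inE.
- move=> u v /a[q [q' [qu q'v /existsP[x /existsP[y /and3P[/eqP xq /eqP yq' xy]]]]]].
  by exists x, y; rewrite !inE xq yq' /= xy.
Qed.

End Quotient.

Inductive word := WJ | WMul of word & word | WI of word | WA of word.

Fixpoint ev (G : graph) (w : word) (a b : G) : nat :=
  match w with
  | WJ => 1
  | WMul w1 w2 => \sum_c ev w1 a c * ev w2 c b
  | WI w => (a == b) * ev w a b
  | WA w => edge a b * ev w a b
  end.

Definition soe (G : graph) (w : word) : nat := \sum_(a : G) \sum_(b : G) ev w a b.

(** Vertices that have to coincide (target and source of consecutive factors, or the two ends under
    [WI]) are kept apart here and joined by equality edges. The vertex type of a product is thus a
    plain sum, and orders can be concatenated. *)
Fixpoint wvertex (w : word) : finType :=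
  match w with
  | WJ => bool
  | WMul w1 w2 => (wvertex w1 + wvertex w2)%type
  | WI w | WA w => wvertex w
  end.

Fixpoint wsrc (w : word) : wvertex w :=
  match w with
  | WJ => false
  | WMul w1 w2 => inl (wsrc w1)
  | WI w => wsrc w
  | WA w => wsrc w
  end.

Fixpoint wtgt (w : word) : wvertex w :=
  match w with
  | WJ => true
  | WMul w1 w2 => inr (wtgt w2)
  | WI w => wtgt w
  | WA w => wtgt w
  end.

Definition pair_rel (T : eqType) (u v : T) : rel T :=
  fun x y => (x == u) && (y == v) || (x == v) && (y == u).

Lemma pair_rel_sym (T : eqType) (u v : T) : symmetric (pair_rel u v).
Proof. by move=> x y; rewrite /pair_rel orbC andbC [in X in _ || X]andbC. Qed.

(* [k] selects the equality edges ([true]) or the adjacency edges ([false]). *)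
Fixpoint wedge (k : bool) (w : word) : rel (wvertex w) :=
  match w return rel (wvertex w) with
  | WJ => fun _ _ => false
  | WMul w1 w2 => fun x y =>
      match x, y with
      | inl x, inl y => @wedge k w1 x y
      | inr x, inr y => @wedge k w2 x y
      | inl x, inr y | inr y, inl x => [&& k, x == wtgt w1 & y == wsrc w2]
      end
  | WI w => fun x y => @wedge k w x y || k && pair_rel (wsrc w) (wtgt w) x y
  | WA w => fun x y => @wedge k w x y || ~~ k && pair_rel (wsrc w) (wtgt w) x y
  end.

Lemma wedge_sym k w : symmetric (@wedge k w).
Proof.
elim: w => [|w1 IH1 w2 IH2|w IH|w IH] //=.
- by case=> [x|x] [y|y].
- by move=> x y; rewrite IH pair_rel_sym.
- by move=> x y; rewrite IH pair_rel_sym.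
Qed.

Fixpoint wsize (w : word) : nat :=
  match w with
  | WJ => 2
  | WMul w1 w2 => wsize w1 + wsize w2
  | WI w | WA w => wsize w
  end.

(** The order without crossings: the source comes first, the target last, and a product places its
    second factor after the first. *)
Fixpoint wpos (w : word) : wvertex w -> nat :=
  match w return wvertex w -> nat with
  | WJ => fun x => nat_of_bool x
  | WMul w1 w2 => fun x =>
      match x with inl x => @wpos w1 x | inr y => wsize w1 + @wpos w2 y end
  | WI w => @wpos w
  | WA w => @wpos w
  end.

Lemma wpos_lt w (x : wvertex w) : wpos x < wsize w.
Proof.
elim: w x => [|w1 IH1 w2 IH2|w IH|w IH] //=; first by case.
case=> [x|y]; last by rewrite ltn_add2l.
exact: leq_trans (IH1 x) (leq_addr _ _).
Qed.

Lemma wpos_src w : wpos (wsrc w) = 0.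
Proof. by elim: w. Qed.

Lemma wpos_tgt w : (wpos (wtgt w)).+1 = wsize w.
Proof. by elim: w => //= w1 IH1 w2 IH2; rewrite -IH2 addnS. Qed.

Lemma wpos_inj w : injective (@wpos w).
Proof.
elim: w => [|w1 IH1 w2 IH2|w IH|w IH] //=; first by do 2!case.
case=> [x|x] [y|y].
- by move/IH1->.
- by have := wpos_lt x; move=> xl e; move: xl; rewrite e -ltn_subRL subnn.
- by have := wpos_lt y; move=> xl e; move: xl; rewrite -e -ltn_subRL subnn.
- by move/addnI/IH2->.
Qed.

Definition wrel w := relU (@wedge false w) (@wedge true w).

(** A chord from the first to the last position is crossed by nothing; hence [WI] and [WA] may add
    it freely. *)
Lemma outer_pair_noncross w (x y z t : wvertex w) :
  pair_rel (wsrc w) (wtgt w) x z \/ pair_rel (wsrc w) (wtgt w) y t ->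
  ~ [/\ wpos x < wpos y, wpos y < wpos z & wpos z < wpos t].
Proof.
have L := wpos_lt t; rewrite -(wpos_tgt w) ltnS in L.
case=> /orP[]/andP[/eqP-> /eqP->]; rewrite !wpos_src; case=> // H1 H2 H3.
by rewrite ltnNge L in H3.
Qed.

Lemma wrel_noncross w (x y z t : wvertex w) : wrel x z -> wrel y t ->
  ~ [/\ wpos x < wpos y, wpos y < wpos z & wpos z < wpos t].
Proof.
rewrite /wrel; elim: w x y z t => [|w1 IH1 w2 IH2|w IH|w IH] //=.
(* The only edge between the two factors joins consecutive positions, and no position lies strictly
   between them. *)
- have H (a b c : nat) : b = a.+1 -> a < c -> c < b -> False.
    by move=> -> ac; rewrite ltnS leqNgt ac.
  have H1 (x : wvertex w1) (y : wvertex w2) : x == wtgt w1 -> y == wsrc w2 ->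
      wsize w1 + wpos y = (wpos x).+1.
    by move=> /eqP-> /eqP->; rewrite wpos_src addn0 wpos_tgt.
  have H2 (x : wvertex w1) (y : wvertex w2) : wsize w1 + wpos y < wpos x -> False.
    move=> l; have := leq_trans (ltn_trans l (wpos_lt x)) (leq_addr (wpos y) _).
    by rewrite ltnn.
  case=> x [] y [] z [] t //= rxz ryt [xy yz zt];
    try exact: (H2 _ _ xy); try exact: (H2 _ _ yz); try exact: (H2 _ _ zt).
  + exact: (IH1 x y z t).
  + by case/andP: ryt => h1 h2; apply: H (H1 _ _ h1 h2) yz zt.
  + by case/andP: rxz => h1 h2; apply: H (H1 _ _ h1 h2) xy yz.
  + by case/andP: rxz => h1 h2; apply: H (H1 _ _ h1 h2) xy yz.
  + by rewrite !ltn_add2l in xy yz zt; apply: (IH2 x y z t).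
- have E (a b p : bool) : [|| a || false, b | p] = (a || b) || p by case: a.
  move=> x y z t; rewrite !E => /orP[rxz|h].
    by case/orP=> [ryt|h]; [exact: (IH x y z t) | exact: (outer_pair_noncross (or_intror h))].
  by move=> _; exact: (outer_pair_noncross (or_introl h)).
- have E (a b p : bool) : [|| a || p, b | false] = (a || b) || p by case: a b p => [] [] [].
  move=> x y z t; rewrite !E => /orP[rxz|h].
    by case/orP=> [ryt|h]; [exact: (IH x y z t) | exact: (outer_pair_noncross (or_intror h))].
  by move=> _; exact: (outer_pair_noncross (or_introl h)).
Qed.

(** Contracting equality edges can create loops, as for [WA (WI WJ)]; this is consistent with
    [outerplanar] being a property of graphs that may have loops. *)
Definition wgraph w : graph := quotient (@wedge_sym true w) (@wedge_sym false w).

Lemma wgraph_outerplanar w : outerplanar (wgraph w).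
Proof.
have rs : symmetric (@wrel w) by move=> x y; rewrite /wrel /= !(wedge_sym _ x).
split=> /minor_quotient.
- exact: noncrossing_no_K4 (@wpos_inj w) rs (@wrel_noncross w) _.
- exact: noncrossing_no_K23 (@wpos_inj w) rs (@wrel_noncross w) _.
Qed.

Definition wok (G : graph) w (f : {ffun wvertex w -> G}) : bool :=
  respects (@wedge true w) (@wedge false w) f.

Lemma wokI (G : graph) w (f : {ffun wvertex w -> G}) :
  @wok G (WI w) f = @wok G w f && (f (wsrc w) == f (wtgt w)).
Proof.
apply/idP/andP => [ok|[ok /eqP e]].
- split.
    apply/forallP=> x; apply/forallP=> y.
    have /forallP/(_ x)/forallP/(_ y)/= := ok; rewrite orbF.
    by case/andP=> -> /implyP h; apply/implyP=> xy; apply: h; rewrite xy.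
  have /forallP/(_ (wsrc w))/forallP/(_ (wtgt w))/= := ok.
  by rewrite /pair_rel !eqxx orbT => /andP[].
- apply/forallP=> x; apply/forallP=> y /=; rewrite orbF.
  have /forallP/(_ x)/forallP/(_ y)/andP[-> /implyP h] := ok.
  apply/implyP=> /orP[/h//|].
  by case/orP=> /andP[/eqP-> /eqP->]; rewrite e.
Qed.

Lemma wokA (G : graph) w (f : {ffun wvertex w -> G}) :
  @wok G (WA w) f = @wok G w f && edge (f (wsrc w)) (f (wtgt w)).
Proof.
apply/idP/andP => [ok|[ok e]].
- split.
    apply/forallP=> x; apply/forallP=> y.
    have /forallP/(_ x)/forallP/(_ y)/= := ok; rewrite orbF.
    by case/andP=> /implyP h ->; rewrite andbT; apply/implyP=> xy; apply: h; rewrite xy.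
  have /forallP/(_ (wsrc w))/forallP/(_ (wtgt w))/= := ok.
  by rewrite /pair_rel !eqxx orbT => /andP[].
- apply/forallP=> x; apply/forallP=> y /=; rewrite orbF.
  have /forallP/(_ x)/forallP/(_ y)/andP[/implyP h ->] := ok; rewrite andbT.
  apply/implyP=> /orP[/h//|].
  by case/orP=> /andP[/eqP-> /eqP->]; rewrite // edge_sym.
Qed.

Definition merge_sum (T1 T2 : finType) (G : Type) (f1 : {ffun T1 -> G})
    (f2 : {ffun T2 -> G}) : {ffun T1 + T2 -> G} :=
  [ffun x => match x with inl y => f1 y | inr y => f2 y end].

Lemma merge_sum_bij (T1 T2 : finType) (G : Type) :
  bijective (fun p : {ffun T1 -> G} * {ffun T2 -> G} => merge_sum p.1 p.2).
Proof.
exists (fun f : {ffun T1 + T2 -> G} => ([ffun x => f (inl x)], [ffun x => f (inr x)])).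
- by case=> f1 f2; congr pair; apply/ffunP=> x; rewrite !ffunE.
- by move=> f; apply/ffunP=> -[x|x]; rewrite !ffunE.
Qed.

Lemma wokMul (G : graph) w1 w2 (f1 : {ffun wvertex w1 -> G}) (f2 : {ffun wvertex w2 -> G}) :
  @wok G (WMul w1 w2) (merge_sum f1 f2) =
  [&& wok f1, wok f2 & f1 (wtgt w1) == f2 (wsrc w2)].
Proof.
apply/idP/and3P => [ok|[ok1 ok2 /eqP e]].
- split.
  + apply/forallP=> x; apply/forallP=> y.
    by have /forallP/(_ (inl x))/forallP/(_ (inl y)) := ok; rewrite !ffunE.
  + apply/forallP=> x; apply/forallP=> y.
    by have /forallP/(_ (inr x))/forallP/(_ (inr y)) := ok; rewrite !ffunE.
  + have /forallP/(_ (inl (wtgt w1)))/forallP/(_ (inr (wsrc w2))) := ok.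
    by rewrite !ffunE /= !eqxx.
- apply/forallP=> -[x|x]; apply/forallP=> -[y|y]; rewrite !ffunE /=.
  + by have /forallP/(_ x)/forallP/(_ y) := ok1.
  + by apply/implyP=> /andP[/eqP-> /eqP->]; rewrite e.
  + by apply/implyP=> /andP[/eqP-> /eqP->]; rewrite e.
  + by have /forallP/(_ x)/forallP/(_ y) := ok2.
Qed.

Lemma evE (G : graph) w (a b : G) :
  ev w a b = \sum_(f : {ffun wvertex w -> G})
    [&& wok f, f (wsrc w) == a & f (wtgt w) == b].
Proof.
elim: w a b => [|w1 IH1 w2 IH2|w IH|w IH] a b.
- pose f0 : {ffun bool -> G} := [ffun x : bool => if x then b else a].
  rewrite /= (bigD1 f0) //= !ffunE !eqxx !andbT big1 ?addn0 => [|f ff0].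
    rewrite (_ : wok _ = true) //.
    by apply/forallP=> x; apply/forallP=> y; rewrite /wedge.
  apply/eqP; rewrite eqb0; apply: contra ff0 => /and3P[_ /eqP fa /eqP fb].
  by apply/eqP/ffunP=> -[]; rewrite ffunE.
- rewrite /= (reindex _ (onW_bij _ (merge_sum_bij _ _ _))) /=.
  rewrite -(pair_bigA _ (fun f1 f2 => nat_of_bool
     [&& @wok G (WMul w1 w2) (merge_sum f1 f2), merge_sum f1 f2 (inl (wsrc w1)) == a
       & merge_sum f1 f2 (inr (wtgt w2)) == b])) /=.
  under eq_bigr => c _ do rewrite IH1 IH2 big_distrlr /=.
  rewrite exchange_big; apply: eq_bigr => f1 _.
  rewrite exchange_big; apply: eq_bigr => f2 _.
  rewrite wokMul !ffunE (bigD1 (f1 (wtgt w1))) //= big1 => [|c /negPf nc].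
    rewrite addn0 eqxx andbT mulnb [f2 _ == f1 _]eq_sym; congr nat_of_bool.
    by case: (wok f1); case: (wok f2); case: (f1 (wtgt w1) == _); case: (f1 _ == a).
  by rewrite eq_sym in nc; rewrite nc !andbF.
- rewrite /= IH big_distrr; apply: eq_bigr => f _ /=.
  rewrite wokI mulnb; congr nat_of_bool.
  have [<-|na] := eqVneq (f (wsrc w)) a; have [<-|nb] := eqVneq (f (wtgt w)) b;
    rewrite ?andbF ?andbT //.
  by rewrite andbC.
- rewrite /= IH big_distrr; apply: eq_bigr => f _ /=.
  rewrite wokA mulnb; congr nat_of_bool.
  have [<-|na] := eqVneq (f (wsrc w)) a; have [<-|nb] := eqVneq (f (wtgt w)) b;
    rewrite ?andbF ?andbT //.
  by rewrite andbC.
Qed.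

Lemma hom_wgraph (G : graph) w : hom (wgraph w) G = soe G w.
Proof.
rewrite hom_quotient -sum1dep_card /soe.
under [RHS]eq_bigr => a _ do (under eq_bigr => b _ do rewrite evE); rewrite -/(wok _).
rewrite big_mkcond /=; symmetry.
under eq_bigr => a _ do rewrite exchange_big /=.
rewrite exchange_big; apply: eq_bigr => f _ /=.
rewrite (bigD1 (f (wsrc w))) //= (bigD1 (f (wtgt w))) //= !eqxx andbT.
rewrite !big1 => [|a /negPf na|b /negPf nb].
- by rewrite !addn0; rewrite /wok; case: ifP.
- by apply: big1 => b _; rewrite eq_sym na andbF.
- by rewrite [_ == b]eq_sym nb !andbF.
Qed.

(** * Minor models and Menger's theorem *)

Section MinorModels.
Variables (V : finType) (r : rel V).
Hypothesis r_sym : symmetric r.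
Implicit Types (A B S : {set V}).

Definition adjacent A B := exists x y, [/\ x \in A, y \in B & r x y].

Lemma adjacent_sym A B : adjacent A B -> adjacent B A.
Proof. by case=> x [y [xA yB rxy]]; exists y, x; rewrite r_sym. Qed.

Lemma adjacent_neq0 A B : adjacent A B -> A != set0.
Proof. by case=> x [y [xA _ _]]; apply/set0Pn; exists x. Qed.

Lemma K4_minor (S A B C D : {set V}) :
  A \subset S -> B \subset S -> C \subset S -> D \subset S ->
  conn r A -> conn r B -> conn r C -> conn r D ->
  [disjoint A & B] -> [disjoint A & C] -> [disjoint A & D] ->
  [disjoint B & C] -> [disjoint B & D] -> [disjoint C & D] ->
  adjacent A B -> adjacent A C -> adjacent A D ->
  adjacent B C -> adjacent B D -> adjacent C D ->
  minor_in (complete 4) r S.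
Proof.
move=> sA sB sC sD cA cB cC cD dAB dAC dAD dBC dBD dCD aAB aAC aAD aBC aBD aCD.
pose phi (i : complete 4) : {set V} := nth set0 [:: A; B; C; D] i.
exists phi; split.
- case=> [[|[|[|[|//]]]] Hi]; rewrite /phi /=.
  + exact: adjacent_neq0 aAB.
  + exact: adjacent_neq0 aBC.
  + exact: adjacent_neq0 aCD.
  + exact: adjacent_neq0 (adjacent_sym aCD).
- by case=> [[|[|[|[|//]]]] Hi].
- by case=> [[|[|[|[|//]]]] Hi].
- case=> [[|[|[|[|//]]]] Hi]; case=> [[|[|[|[|//]]]] Hj] // _;
    by rewrite /phi /= 1?disjoint_sym.
- case=> [[|[|[|[|//]]]] Hi]; case=> [[|[|[|[|//]]]] Hj] // _;
    by rewrite /phi /=; apply: adjacent_sym.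
Qed.

Lemma K23_minor (S P Q X Y Z : {set V}) :
  P \subset S -> Q \subset S -> X \subset S -> Y \subset S -> Z \subset S ->
  conn r P -> conn r Q -> conn r X -> conn r Y -> conn r Z ->
  [disjoint P & Q] -> [disjoint P & X] -> [disjoint P & Y] -> [disjoint P & Z] ->
  [disjoint Q & X] -> [disjoint Q & Y] -> [disjoint Q & Z] ->
  [disjoint X & Y] -> [disjoint X & Z] -> [disjoint Y & Z] ->
  adjacent P X -> adjacent P Y -> adjacent P Z ->
  adjacent Q X -> adjacent Q Y -> adjacent Q Z ->
  minor_in (complete_bipartite 2 3) r S.
Proof.
move=> sP sQ sX sY sZ cP cQ cX cY cZ dPQ dPX dPY dPZ dQX dQY dQZ dXY dXZ dYZ.
move=> aPX aPY aPZ aQX aQY aQZ.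
pose phi (i : complete_bipartite 2 3) : {set V} :=
  match i with
  | inl i => nth set0 [:: P; Q] i
  | inr i => nth set0 [:: X; Y; Z] i
  end.
exists phi; split.
- case=> [[[|[|//]] Hi]|[[|[|[|//]]] Hi]]; rewrite /phi /=.
  + exact: adjacent_neq0 aPX.
  + exact: adjacent_neq0 aQX.
  + exact: adjacent_neq0 (adjacent_sym aPX).
  + exact: adjacent_neq0 (adjacent_sym aPY).
  + exact: adjacent_neq0 (adjacent_sym aPZ).
- by case=> [[[|[|//]] Hi]|[[|[|[|//]]] Hi]].
- by case=> [[[|[|//]] Hi]|[[|[|[|//]]] Hi]].
- case=> [[[|[|//]] Hi]|[[|[|[|//]]] Hi]]; case=> [[[|[|//]] Hj]|[[|[|[|//]]] Hj]] // _;
    by rewrite /phi /= 1?disjoint_sym.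
- case=> [[[|[|//]] Hi]|[[|[|[|//]]] Hi]]; case=> [[[|[|//]] Hj]|[[|[|[|//]]] Hj]] // _;
    by rewrite /phi /= //; apply: adjacent_sym.
Qed.

End MinorModels.

(** Here [r1] on [S1] is obtained by contracting the connected set [D] onto [c]. Undoing the
    contraction enlarges the branch set that contains [c], if there is one, by [D]; the others avoid
    [D], which meets [S1] in [c] at most. An edge of [r1] at [c] may come from any vertex of [D]. *)
Lemma minor_in_contract (M : sgraph) (V : finType) (r1 r : rel V)
    (S1 S D : {set V}) c :
  symmetric r -> S1 \subset S -> D \subset S -> conn r D -> c \in D ->
  S1 :&: D \subset [set c] ->
  (forall x y, x \in S1 -> y \in S1 -> r1 x y ->
     [\/ r x y, x = c /\ exists2 d, d \in D & r d y
      | y = c /\ exists2 d, d \in D & r x d]) ->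
  minor_in M r1 S1 -> minor_in M r S.
Proof.
move=> rs sS1 sD cD cinD S1D step [phi [ne sub cp d a]].
pose psi u := if c \in phi u then phi u :|: D else phi u.
have phi_psi u : phi u \subset psi u.
  by rewrite /psi; case: ifP => // _; apply: subsetUl.
have D_psi u : c \in phi u -> D \subset psi u.
  by rewrite /psi => ->; apply: subsetUr.
have phiD u : c \notin phi u -> [disjoint phi u & D].
  move=> ncu; rewrite -setI_eq0; apply/eqP/setP=> x; rewrite !inE.
  apply/negbTE/negP=> /andP[xu xD]; case/negP: ncu.
  suff /set1P<- : x \in [set c] by [].
  by apply: (subsetP S1D); rewrite inE xD (subsetP (sub u)).
have csym u : connect_sym (restr r (psi u)) by apply/sym_connect_sym/restr_sym.
have D_conn u x y : c \in phi u -> x \in D -> y \in D -> connect (restr r (psi u)) x y.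
  by move=> cu xD yD; apply: connect_restr_sub (cD x y xD yD) => //; apply: D_psi.
have phi_conn u x y : x \in phi u -> y \in phi u -> connect (restr r (psi u)) x y.
  move=> xu yu; apply: connect_sub (cp u x y xu yu) => {x y xu yu} x y /and3P[xu yu rxy].
  have xp := subsetP (phi_psi u) x xu; have yp := subsetP (phi_psi u) y yu.
  have xS := subsetP (sub u) x xu; have yS := subsetP (sub u) y yu.
  case: (step x y xS yS rxy) => [rxy'|[xc [z zD rzy]]|[yc [z zD rxz]]].
  - by apply: connect1; rewrite /restr /= xp yp.
  - rewrite xc in xu *; apply: connect_trans (D_conn u c z xu cinD zD) _.
    by apply: connect1; rewrite /restr /= yp (subsetP (D_psi u xu)).
  - rewrite yc in yu *; apply: connect_trans (D_conn u z c yu zD cinD).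
    by apply: connect1; rewrite /restr /= xp (subsetP (D_psi u yu)).
have root u : exists2 z, z \in phi u & forall x, x \in psi u -> connect (restr r (psi u)) z x.
  have [cu|ncu] := boolP (c \in phi u).
    exists c => // x; rewrite {1}/psi cu => /setUP[xu|xD]; [exact: phi_conn | exact: D_conn].
  have /set0Pn[z zu] := ne u; exists z => // x.
  by rewrite {1}/psi (negPf ncu) => xu; apply: phi_conn.
exists psi; split.
- by move=> u; have /set0Pn[z zu] := ne u; apply/set0Pn; exists z; apply: (subsetP (phi_psi u)).
- move=> u; rewrite /psi; case: ifP => _; rewrite ?subUset ?sD ?andbT;
    exact: subset_trans (sub u) sS1.
- move=> u x y xu yu; have [z zu zP] := root u.
  by apply: connect_trans (zP y yu); rewrite csym; apply: zP.
- move=> u v uv; have duv := d u v uv; rewrite /psi.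
  case: ifP => cu; case: ifP => cv //.
  + by rewrite (disjointFr duv cu) in cv.
  + rewrite -setI_eq0 setIUl; have := duv; rewrite -setI_eq0 => /eqP->.
    by rewrite set0U setI_eq0 disjoint_sym; apply: phiD; rewrite cv.
  + rewrite -setI_eq0 setIUr; have := duv; rewrite -setI_eq0 => /eqP->.
    by rewrite set0U setI_eq0; apply: phiD; rewrite cu.
- move=> u v /a[x [y [xu yv rxy]]].
  have xp := subsetP (phi_psi u) x xu; have yp := subsetP (phi_psi v) y yv.
  have xS := subsetP (sub u) x xu; have yS := subsetP (sub v) y yv.
  case: (step x y xS yS rxy) => [rxy'|[xc [z zD rzy]]|[yc [z zD rxz]]].
  + by exists x, y.
  + by rewrite xc in xu; exists z, y; split=> //; apply: (subsetP (D_psi u xu)).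
  + by rewrite yc in yv; exists x, z; split=> //; apply: (subsetP (D_psi v yv)).
Qed.

Section Menger.
Variables (V : finType) (r : rel V).
Hypothesis r_sym : symmetric r.
Implicit Types (A B K S W : {set V}).

(** Connected sets take the place of paths: they serve directly as branch sets, and they can be
    enlarged without keeping a path structure. *)
Definition link K A B W : Prop :=
  [/\ W \subset K, conn r W, exists2 a, a \in A & a \in W & exists2 b, b \in B & b \in W].

Definition linked K A B : bool :=
  [exists a in A :&: K, exists b in B :&: K, connect (restr r K) a b].

Lemma linkedP K A B : linked K A B -> exists W, link K A B W.
Proof.
case/existsP=> a /andP[/setIP[aA aK] /existsP[b /andP[/setIP[bB bK] ab]]].
exists (component r K a); split; first exact: component_sub.
- exact: conn_component.
- by exists a => //; apply: mem_component.
- by exists b; rewrite ?inE.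
Qed.

Lemma link_sub K1 K2 A B W : K1 \subset K2 -> link K1 A B W -> link K2 A B W.
Proof. by move=> sK [WK cW mA mB]; split=> //; apply: subset_trans sK. Qed.

Lemma link_extend K A B W a x : a \in K -> a \in A -> x \in W -> r a x ->
  W \subset K -> conn r W -> (exists2 b, b \in B & b \in W) -> link K A B (a |: W).
Proof.
move=> aK aA xW rax WK cW [b bB bW]; split.
- by rewrite subUset sub1set aK.
- by apply: (connU r_sym (@conn1 _ r a) cW (set11 a) xW); rewrite rax orbT.
- by exists a; rewrite ?setU11.
- by exists b => //; apply: setU1r.
Qed.

Definition two_links K A B :=
  exists Y Z, [/\ link K A B Y, link K A B Z & [disjoint Y & Z]].

(* Menger's theorem for two disjoint paths, by contracting a vertex of [A]
   onto its neighbourhood. *)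
Lemma menger2 K A B :
  [\/ ~~ linked K A B,
      exists2 c, c \in K & ~~ linked (K :\ c) A B
    | two_links K A B].
Proof.
have [n] := ubnP #|K|; elim: n => // n IH in K A *; rewrite ltnS => Kn.
have [lK|nlK] := boolP (linked K A B); last by constructor 1.
have /existsP[a /andP[/setIP[aA aK] _]] := lK.
pose K' := K :\ a.
have [lK'|nlK'] := boolP (linked K' A B); last by constructor 2; exists a.
have sK : K' \subset K by apply: subsetDl.
have [W lW] := linkedP lK'; have [WK' cW [a' a'A a'W] mB] := lW.
have nKa (X : {set V}) : X \subset K' -> a \notin X.
  by move=> sX; apply/negP=> /(subsetP sX); rewrite !inE eqxx.
have dis1 (X : {set V}) : X \subset K' -> [disjoint [set a] & X] by rewrite disjoints1; apply: nKa.
have [aB|naB] := boolP (a \in B).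
  constructor 3; exists [set a], W; split.
  - split; rewrite ?sub1set //; first exact: conn1.
    + by exists a => //; apply: set11.
    + by exists a => //; apply: set11.
  - exact: link_sub lW.
  - exact: dis1.
pose A' := A :|: [set x | r a x].
have cK' : #|K'| < n by rewrite /K' (cardsD1 a K) aK in Kn *; lia.
case: (IH K' A' cK') => [nl|[c cK nl]|].
- case/negP: nl; case/existsP: lK' => x /andP[/setIP[xA xK] h].
  by apply/existsP; exists x; rewrite in_setI in_setU xA xK.
(* A vertex [c] that separates [A'] from [B] without [a] also separates [A] from [B] in [K]: going
   back from [B], a connection to [A] either avoids [a] or reaches it from a neighbour, which
   belongs to [A']. *)
- constructor 2; exists c; first exact: (subsetP sK).
  apply: contra nl => /existsP[a0 /andP[/setIP[a0A a0K]]].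
  case/existsP=> b0 /andP[/setIP[b0B b0K] ab].
  have b0K' : b0 \in K' :\ c.
    move: b0K; rewrite !inE => /andP[-> ->]; rewrite andbT /=.
    by apply: contraNneq naB => <-.
  have cs := sym_connect_sym (restr_sym (K :\ c) r_sym).
  have cs' := sym_connect_sym (restr_sym (K' :\ c) r_sym).
  have fin x : x \in component r (K' :\ c) b0 -> x \in A' -> linked (K' :\ c) A' B.
    move=> xc xA'; apply/existsP; exists x; rewrite inE xA' (subsetP (component_sub r b0K') x xc) /=.
    by apply/existsP; exists b0; rewrite inE b0B b0K' /= cs'; rewrite inE in xc.
  have [a0c|na0c] := boolP (a0 \in component r (K' :\ c) b0).
    by apply: fin a0c _; rewrite inE a0A.
  rewrite cs in ab.
  have [x [y [xK yK xc nyc rxy]]] := @connect_cut _ _ _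
     (mem (component r (K' :\ c) b0)) b0 a0 ab (mem_component _ _ _) na0c.
  have [ya|ya] := eqVneq y a.
    by apply: (fin x xc); rewrite !inE r_sym -ya rxy orbT.
  case/negP: nyc; apply: (component_closed b0K' xc _ rxy).
  by move: yK; rewrite !inE ya.
- case=> Y [Z [lY lZ dYZ]]; constructor 3.
  (* It suffices that one of the two links starts in [A] itself: the other one may start at a
     neighbour of [a] and is then prolonged by [a]. *)
  have ext Y1 Z1 : link K' A B Y1 -> link K' A' B Z1 -> [disjoint Y1 & Z1] ->
      two_links K A B.
    move=> lY1 [Z1K cZ1 [x xA' xZ1] mZ] d1.
    have Y1K : Y1 \subset K' by case: lY1.
    move: xA'; rewrite !inE => /orP[xA|rax].
      exists Y1, Z1; split=> //; first exact: link_sub lY1.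
      by apply: (link_sub sK); split=> //; exists x.
    exists Y1, (a |: Z1); split.
    - exact: link_sub lY1.
    - by apply: (link_extend aK aA xZ1 rax) => //; apply: subset_trans sK.
    - by rewrite disjoint_sym -setI_eq0 setIUl setU_eq0 !setI_eq0 dis1 //= disjoint_sym.
  (* If neither link meets [A], the link [W], which avoids [a], is followed from its vertex [a'] in
     [A] until it touches one of them. The part [X] of [W] found so far, joined to the link that is
     touched, is a link from [A], and it is still disjoint from the other. *)
  have half Y1 Z1 x y : link K' A' B Y1 -> link K' A' B Z1 -> [disjoint Y1 & Z1] ->
      x \in component r (W :\: (Y1 :|: Z1)) a' -> y \in Y1 -> r x y ->
      a' \in W :\: (Y1 :|: Z1) -> two_links K A B.
    move=> [Y1K cY1 _ mY1] lZ1 d1 xX yY1 rxy a'X.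
    pose X := component r (W :\: (Y1 :|: Z1)) a'.
    have XW : X \subset W :\: (Y1 :|: Z1) by apply: component_sub.
    apply: (ext (X :|: Y1) Z1) => //.
      split; last first.
      - by case: mY1 => b bB bY; exists b => //; rewrite inE bY orbT.
      - by exists a' => //; rewrite inE mem_component.
      - by apply: (connU r_sym (conn_component r_sym a'X) cY1 xX yY1); rewrite rxy orbT.
      - rewrite subUset Y1K andbT; apply: subset_trans WK'.
        exact: subset_trans XW (subsetDl _ _).
    rewrite -setI_eq0 setIUl setU_eq0 !setI_eq0 d1 andbT.
    apply: disjointWl XW _; rewrite -setI_eq0; apply/eqP/setP=> z.
    by rewrite !inE; case: (z \in Z1); rewrite ?andbF // orbT.
  have [YA|nYA] := boolP [exists x, (x \in A) && (x \in Y)].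
    case/existsP: YA => x /andP[xA xY].
    by case: lY => sY cY _ mY; apply: (ext Y Z) => //; split=> //; exists x.
  have [ZA|nZA] := boolP [exists x, (x \in A) && (x \in Z)].
    case/existsP: ZA => x /andP[xA xZ].
    case: lZ => sZ cZ _ mZ; apply: (ext Z Y) => //; last by rewrite disjoint_sym.
    by split=> //; exists x.
  have a'YZ : a' \in W :\: (Y :|: Z).
    rewrite !inE a'W andbT negb_or; apply/andP; split.
      by apply: contra nYA => h; apply/existsP; exists a'; rewrite a'A.
    by apply: contra nZA => h; apply/existsP; exists a'; rewrite a'A.
  have [dW|] := boolP [disjoint W & Z]; first exact: (ext W Z).
  case/pred0Pn=> z /andP[/= zW zZ].
  have nz : z \notin component r (W :\: (Y :|: Z)) a'.
    by apply/negP=> /(subsetP (component_sub r a'YZ)); rewrite !inE zZ orbT.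
  have [x [y [xW yW xX nyX rxy]]] := @conn_cut _ _ _
     (mem (component r (W :\: (Y :|: Z)) a')) a' z cW a'W zW (mem_component _ _ _) nz.
  have : y \in Y :|: Z.
    apply: contraNT nyX => nyYZ; apply: (component_closed a'YZ xX _ rxy).
    by rewrite inE nyYZ.
  case/setUP=> [yY|yZ]; first exact: (half Y Z x y).
  by apply: (half Z Y x y) => //; rewrite 1?disjoint_sym 1?[Z :|: Y]setUC.
Qed.

Lemma connect_linked S u v : u \in S -> v \in S -> u != v -> ~~ r u v ->
  v \in component r S u ->
  linked (S :\ u :\ v) [set x | r u x] [set x | r v x].
Proof.
move=> uS vS uv nruv; rewrite inE => cuv; apply: contraT => nl.
set K := S :\ u :\ v in nl.
(* [X] holds at [u] and at everything that its neighbours reach inside [K]. If the neighbourhoods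
   were not linked, no edge could leave [X] within [S], although [v] is connected to [u]. *)
pose X : pred V := [pred y | (y == u) || (y \in K) &&
   [exists a, [&& r u a, a \in K & connect (restr r K) a y]]].
have Xu : X u by rewrite /X /= eqxx.
have nXv : ~~ X v by rewrite /X /= eq_sym (negPf uv) !inE eqxx.
have [x [y [xS yS Xx nXy rxy]]] := connect_cut cuv Xu nXv.
have yu : y != u by apply: contraNneq nXy => ->; rewrite /X /= eqxx.
case/orP: Xx => [/eqP xu|/andP[xK /existsP[a /and3P[rua aK cax]]]].
  have yv : y != v by apply: contraNneq nruv => <-; rewrite -xu.
  have yK : y \in K by rewrite !inE yu yv.
  case/negP: nXy; rewrite /X /= yK (negPf yu) /=; apply/existsP; exists y.
  by rewrite yK connect0 -xu rxy.
have [yv|yv] := eqVneq y v.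
  case/negP: nl; apply/existsP; exists a; rewrite !inE rua -/K.
  move: aK; rewrite !inE => ->; apply/existsP; exists x.
  by move: xK; rewrite !inE r_sym -yv rxy => ->.
have yK : y \in K by rewrite !inE yu yv.
case/negP: nXy; rewrite /X /= yK (negPf yu) /=; apply/existsP; exists a.
rewrite rua aK /=; apply: connect_trans cax _.
by apply: connect1; rewrite /restr /= xK yK.
Qed.

(** Extremal choice: [w] in [N], other than [n0], maximises the component of [n0] in [K] without
    [w]. If this component missed some other [n] in [N], deleting [n] instead would leave the whole
    component connected to [w], so the component of [n0] would be larger. *)
Lemma nonseparating_vertex K (N : {set V}) n0 : conn r K -> N \subset K -> n0 \in N ->
  exists2 w, w \in N & forall x y, x \in N :\ w -> y \in N :\ w ->
    connect (restr r (K :\ w)) x y.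
Proof.
move=> cK NK n0N.
have [/existsP[w0 w0N]|nN] := boolP [exists w, w \in N :\ n0]; last first.
  by exists n0 => // x y xN; case/existsP: nN; exists x.
have n0K := subsetP NK n0 n0N.
pose C w := component r (K :\ w) n0.
case: (arg_maxnP (fun w => #|C w|) w0N) => w wN wmax.
have /setD1P[wn0 wN'] := wN; have wK := subsetP NK w wN'.
have n0Kw : n0 \in K :\ w by rewrite !inE eq_sym wn0.
have sC : C w \subset K :\ w by apply: component_sub.
have nwC : w \notin C w by apply/negP=> /(subsetP sC); rewrite !inE eqxx.
have main n : n \in N :\ w -> n \in C w.
  case/setD1P=> nw nN; have nK := subsetP NK n nN.
  have [->|nn0] := eqVneq n n0; first exact: mem_component.
  apply: contraT => nCn.
  have nNn0 : n \in N :\ n0 by rewrite !inE nn0.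
  have n0Kn : n0 \in K :\ n by rewrite !inE eq_sym nn0.
  have [x [y [xK yK xC nyC rxy]]] := @conn_cut _ _ _ (mem (C w)) n0 w cK n0K wK (mem_component _ _ _) nwC.
  have yw : y = w.
    apply/eqP; apply: contraNT nyC => yw; apply: (component_closed n0Kw xC _ rxy).
    by rewrite !inE yw.
  rewrite yw in rxy.
  have : w |: C w \subset C n.
    apply: (conn_sub_component (x := n0)); last by rewrite setU1r // mem_component.
      apply: (connU r_sym (@conn1 _ r w) (conn_component r_sym n0Kw) (set11 w) xC).
      by rewrite r_sym rxy orbT.
    rewrite subUset sub1set !inE eq_sym nw wK /=; apply/subsetP=> z zC.
    have := subsetP sC z zC; rewrite !inE => /andP[_ ->]; rewrite andbT.
    by apply: contraNneq nCn => <-.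
  move/subset_leq_card; rewrite cardsU1 nwC add1n => lt.
  by have := leq_trans lt (wmax n nNn0); rewrite ltnn.
exists w => // x y /main xC /main yC.
rewrite !inE in xC yC; apply: connect_trans yC.
by rewrite (sym_connect_sym (restr_sym _ r_sym)).
Qed.

End Menger.

(** * Decomposition of outerplanar graphs *)

Section PartialHoms.
Variables (V : finType) (G : graph).
Implicit Types (r : rel V) (S : {set V}) (f : {ffun V -> option G}).

Definition edge_ok f x y : bool :=
  match f x, f y with Some a, Some b => edge a b | _, _ => true end.

(** Homomorphisms from the subgraph induced by [S], encoded as functions on all of [V] that are
    [None] exactly outside [S]. Counts for different [S] thus concern the same function type, and
    restriction and merging are simple. *)
Definition phom r S f : bool :=
  [forall x, isSome (f x) == (x \in S)] &&
  [forall x, forall y, r x y ==> edge_ok f x y].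

Definition phoms r S u v (a b : G) : nat :=
  #|[set f | [&& phom r S f, f u == Some a & f v == Some b]]|.

Lemma phomP r S f :
  reflect ((forall x, isSome (f x) = (x \in S)) /\ (forall x y, r x y -> edge_ok f x y))
    (phom r S f).
Proof.
apply: (iffP andP) => -[h1 h2]; split.
- by move=> x; apply/eqP; apply: (forallP h1).
- by move=> x y; have /forallP/(_ y)/implyP := forallP h2 x.
- by apply/forallP=> x; rewrite h1.
- by apply/forallP=> x; apply/forallP=> y; apply/implyP; apply: h2.
Qed.

Lemma phom_eq r1 r2 S f : {in S &, r1 =2 r2} -> phom r1 S f = phom r2 S f.
Proof.
have sub (q1 q2 : rel V) : {in S &, q1 =2 q2} -> phom q1 S f -> phom q2 S f.
  move=> q12 /phomP[d h]; apply/phomP; split=> // x y q.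
  have [xS|xS] := boolP (x \in S); last first.
    by rewrite /edge_ok; have := d x; rewrite (negPf xS); case: (f x).
  have [yS|yS] := boolP (y \in S); last first.
    by rewrite /edge_ok; have := d y; rewrite (negPf yS); case: (f x) (f y) => [?|] [?|].
  by apply: h; rewrite q12.
by move=> r12; apply/idP/idP; apply: sub => // x y xS yS; rewrite r12.
Qed.

Lemma phoms_eq r1 r2 S u v a b :
  {in S &, r1 =2 r2} -> phoms r1 S u v a b = phoms r2 S u v a b.
Proof.
by move=> r12; congr #|pred_of_set _|; apply/setP=> f; rewrite !inE (phom_eq _ r12).
Qed.

Definition frestr S f : {ffun V -> option G} := [ffun x => if x \in S then f x else None].

Definition fmerge S f1 f2 : {ffun V -> option G} :=
  [ffun x => if x \in S then f1 x else f2 x].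

(** Restriction to both parts is inverse to merging. [Q1] and [Q2] prescribe images and must force
    agreement on the overlap; no edge runs between the parts outside the overlap, so a merged
    function respects all edges. *)
Lemma card_phom_merge r S1 S2 (Q1 Q2 : pred {ffun V -> option G}) :
  (forall x y, x \in S1 :|: S2 -> y \in S1 :|: S2 -> r x y ->
     (x \in S1) && (y \in S1) || (x \in S2) && (y \in S2)) ->
  (forall f1 f2, phom r S1 f1 -> Q1 f1 -> phom r S2 f2 -> Q2 f2 ->
     forall x, x \in S1 -> x \in S2 -> f1 x = f2 x) ->
  #|[set f | [&& phom r (S1 :|: S2) f, Q1 (frestr S1 f) & Q2 (frestr S2 f)]]| =
  #|[set f | phom r S1 f && Q1 f]| * #|[set f | phom r S2 f && Q2 f]|.
Proof.
move=> nc agree; rewrite -cardsX.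
set A := setX _ _.
have AP p : p \in A -> [/\ phom r S1 p.1, Q1 p.1, phom r S2 p.2 & Q2 p.2].
  by rewrite !inE => /andP[/andP[-> ->] /andP[-> ->]].
have m1 p : p \in A -> frestr S1 (fmerge S1 p.1 p.2) = p.1.
  case/AP=> /phomP[d _] _ _ _; apply/ffunP=> x; rewrite !ffunE.
  by rewrite -d; case: (p.1 x).
have m2 p : p \in A -> frestr S2 (fmerge S1 p.1 p.2) = p.2.
  case/AP=> h1 q1 h2 q2; have /phomP[d _] := h2; apply/ffunP=> x; rewrite !ffunE.
  have [x2|nx2] := boolP (x \in S2); last by have := d x; rewrite (negPf nx2); case: (p.2 x).
  by case: ifP => // x1; apply: agree h1 q1 h2 q2 _ _ _.
have inj : {in A &, injective (fun p => fmerge S1 p.1 p.2)}.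
  move=> p q pA qA /= e.
  have e1 : p.1 = q.1 by rewrite -(m1 p pA) e m1.
  have e2 : p.2 = q.2 by rewrite -(m2 p pA) e m2.
  by rewrite [p]surjective_pairing e1 e2 -surjective_pairing.
rewrite -(card_in_imset inj); congr #|pred_of_set _|; apply/setP=> f.
rewrite inE; apply/and3P/imsetP => [[/phomP[d h] q1 q2]|[p pA ->]].
- exists (frestr S1 f, frestr S2 f); last first.
    apply/ffunP=> x; rewrite !ffunE /=; have := d x; rewrite inE.
    by case: (x \in S1); case: (x \in S2); case: (f x).
  rewrite !inE /= q1 q2 !andbT; apply/andP; split; apply/phomP; split=> x.
  + by rewrite ffunE; have := d x; rewrite inE; case: (x \in S1).
  + move=> y /h; rewrite /edge_ok !ffunE; do 2!case: ifP => // _.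
    by case: (f x).
  + by rewrite ffunE; have := d x; rewrite inE orbC; case: (x \in S2).
  + move=> y /h; rewrite /edge_ok !ffunE; do 2!case: ifP => // _.
    by case: (f x).
- have [/phomP[d1 h1] q1 /phomP[d2 h2] q2] := AP p pA.
  rewrite m1 // m2 //; split=> //; apply/phomP; split=> [x|x y rxy].
    by rewrite ffunE inE; case: ifP => x1; rewrite ?d1 ?d2 ?x1.
  have d x' : isSome (fmerge S1 p.1 p.2 x') = (x' \in S1 :|: S2).
    by rewrite ffunE inE; case: ifP => x1; rewrite ?d1 ?d2 ?x1.
  have r1 x' : x' \in S1 -> fmerge S1 p.1 p.2 x' = p.1 x'.
    by rewrite ffunE => ->.
  have r2 x' : x' \in S2 -> fmerge S1 p.1 p.2 x' = p.2 x'.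
    by move=> x2; rewrite -{2}(m2 p pA) [RHS]ffunE x2.
  have [xS|xS] := boolP (x \in S1 :|: S2); last first.
    by rewrite /edge_ok; have := d x; rewrite (negPf xS); case: (fmerge S1 p.1 p.2 x).
  have [yS|yS] := boolP (y \in S1 :|: S2); last first.
    rewrite /edge_ok; have := d y; rewrite (negPf yS).
    by case: (fmerge S1 p.1 p.2 x) (fmerge S1 p.1 p.2 y) => [?|] [?|].
  case/orP: (nc x y xS yS rxy) => /andP[xi yi].
  + by have := h1 x y rxy; rewrite /edge_ok !r1.
  + by have := h2 x y rxy; rewrite /edge_ok !r2.
Qed.

Lemma card_split_value (A : {set {ffun V -> option G}}) c :
  (forall f, f \in A -> isSome (f c)) ->
  #|A| = \sum_d #|[set f in A | f c == Some d]|.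
Proof.
move=> sA; rewrite -sum1_card.
under [RHS]eq_bigr => d _ do rewrite -sum1dep_card big_mkcondr.
rewrite exchange_big; apply: eq_bigr => f /sA; case: (f c) => // d _.
rewrite (bigD1 d) //= eqxx big1 // => d' /negPf nd; rewrite ifF //.
by apply/eqP=> -[e]; rewrite e eqxx in nd.
Qed.

Lemma phoms_split_value r S u v w a b : w \in S ->
  phoms r S u v a b =
  \sum_d #|[set f | [&& phom r S f, f u == Some a, f v == Some b & f w == Some d]]|.
Proof.
move=> wS; rewrite /phoms (@card_split_value _ w); last first.
  by move=> f; rewrite inE => /and3P[/phomP[-> _]].
apply: eq_bigr => d _; congr #|pred_of_set _|; apply/setP=> f.
by rewrite !inE -!andbA.
Qed.

Lemma phoms_glue r S1 S2 u v c a b :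
  (forall x y, x \in S1 :|: S2 -> y \in S1 :|: S2 -> r x y ->
     (x \in S1) && (y \in S1) || (x \in S2) && (y \in S2)) ->
  S1 :&: S2 = [set c] -> u \in S1 -> v \in S2 ->
  phoms r (S1 :|: S2) u v a b = \sum_d phoms r S1 u c a d * phoms r S2 c v d b.
Proof.
move=> nc S12 u1 v2.
have /setIP[c1 c2] : c \in S1 :&: S2 by rewrite S12 set11.
rewrite (@phoms_split_value r _ u v c) ?inE ?c1 //.
apply: eq_bigr => d _; rewrite -card_phom_merge => //.
  congr #|pred_of_set _|; apply/setP=> f; rewrite !inE !ffunE u1 v2 c1 c2.
  case: (phom _ _ _) => //=; case: (f u == _) => //=.
  by case: (f c == _); rewrite /= ?andbT ?andbF.
move=> f1 f2 _ /andP[_ /eqP e1] _ /andP[/eqP e2 _] x x1 x2.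
have : x \in S1 :&: S2 by rewrite inE x1.
by rewrite S12 => /set1P->; rewrite e1 e2.
Qed.

Lemma phoms_disjoint r S1 S2 u v a b :
  (forall x y, x \in S1 :|: S2 -> y \in S1 :|: S2 -> r x y ->
     (x \in S1) && (y \in S1) || (x \in S2) && (y \in S2)) ->
  [disjoint S1 & S2] -> u \in S1 -> v \in S2 ->
  phoms r (S1 :|: S2) u v a b = phoms r S1 u u a a * phoms r S2 v v b b.
Proof.
move=> nc dis u1 v2; rewrite -card_phom_merge => //.
  congr #|pred_of_set _|; apply/setP=> f; rewrite !inE !ffunE u1 v2.
  by rewrite !andbb.
by move=> f1 f2 _ _ _ _ x x1; rewrite (disjointFr dis x1).
Qed.

Lemma phoms_diag_neq r S u a b : a != b -> phoms r S u u a b = 0.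
Proof.
move=> nab; apply/eqP; rewrite cards_eq0; apply/eqP/setP=> f; rewrite !inE.
apply/negP=> /and3P[_ /eqP-> /eqP[e]]; by rewrite e eqxx in nab.
Qed.

Lemma phoms_diag_sum r S u w a : w \in S ->
  phoms r S u u a a = \sum_d phoms r S u w a d.
Proof.
move=> wS; rewrite (@phoms_split_value r _ u u w) //; apply: eq_bigr => d _.
congr #|pred_of_set _|; apply/setP=> f; rewrite !inE.
by case: (f u == _); rewrite //= ?andbF.
Qed.

Lemma phoms_edge r S u v a b : symmetric r -> r u v ->
  phoms r S u v a b =
  edge a b * phoms (fun x y => r x y && ~~ pair_rel u v x y) S u v a b.
Proof.
move=> rs ruv.
set r' := fun x y => _.
have sub f : phom r S f -> phom r' S f.
  by case/phomP=> d h; apply/phomP; split=> // x y /andP[/h].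
have [eab|neab] := boolP (edge a b); last first.
  rewrite mul0n; apply/eqP; rewrite cards_eq0; apply/eqP/setP=> f; rewrite !inE.
  apply/negP=> /and3P[/phomP[_ h] /eqP fu /eqP fv].
  by have := h u v ruv; rewrite /edge_ok fu fv (negPf neab).
rewrite mul1n; congr #|pred_of_set _|; apply/setP=> f; rewrite !inE.
apply/and3P/and3P=> -[p fu fv]; split=> //; first exact: sub.
have /phomP[d h] := p; apply/phomP; split=> // x y rxy.
have [|np] := boolP (pair_rel u v x y); last by apply: h; rewrite /r' rxy.
by case/orP=> /andP[/eqP-> /eqP->]; rewrite /edge_ok (eqP fu) (eqP fv) // edge_sym.
Qed.

Lemma phoms_set1 r u a b : irreflexive r ->
  phoms r [set u] u u a b = (a == b).
Proof.
move=> ri; have [<-|nab] := eqVneq a b; last exact: phoms_diag_neq.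
pose f0 : {ffun V -> option G} := [ffun x => if x == u then Some a else None].
rewrite /phoms (_ : [set f | _] = [set f0]) ?cards1 //; apply/setP=> f; rewrite !inE.
rewrite andbb; apply/andP/eqP => [[/phomP[d _] /eqP fu]|->].
  apply/ffunP=> x; rewrite ffunE; case: eqP => [->//|/eqP xu].
  by have := d x; rewrite inE (negPf xu); case: (f x).
split; last by rewrite ffunE eqxx.
apply/phomP; split=> [x|x y rxy]; first by rewrite ffunE inE; case: ifP.
rewrite /edge_ok !ffunE; do 2!case: eqP => //.
by move=> yu xu; rewrite xu yu ri in rxy.
Qed.

End PartialHoms.

Lemma hom_phoms (F G : graph) (u : F) :
  hom F G = \sum_(a : G) \sum_(b : G) phoms (@edge F) setT u u a b.
Proof.
transitivity (\sum_(a : G) phoms (@edge F) setT u u a a); last first.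
  apply: eq_bigr => a _; rewrite (bigD1 a) //= big1 ?addn0 // => b nba.
  by apply: phoms_diag_neq; rewrite eq_sym.
pose h (f : {ffun F -> G}) : {ffun F -> option G} := [ffun x => Some (f x)].
have hinj : injective h.
  by move=> f g /ffunP e; apply/ffunP=> x; have := e x; rewrite !ffunE => -[].
rewrite /hom -(card_imset _ hinj) (@card_split_value _ _ _ u); last first.
  by move=> f /imsetP[g _ ->]; rewrite ffunE.
apply: eq_bigr => a _; congr #|pred_of_set _|; apply/setP=> f; rewrite !inE andbb.
congr andb; apply/imsetP/phomP => [[g]|[d e]].
  rewrite inE => /forallP hg ->; split=> [x|x y xy]; first by rewrite ffunE inE.
  by rewrite /edge_ok !ffunE; have /forallP/(_ y)/implyP := hg x; apply.
have dS x : isSome (f x) by rewrite d inE.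
have /fin_all_exists[g gP] : forall x, exists b, f x = Some b.
  by move=> x; have := dS x; case: (f x) => // b _; exists b.
exists [ffun x => g x]; last by apply/ffunP=> x; rewrite !ffunE gP.
rewrite inE; apply/forallP=> x; apply/forallP=> y; apply/implyP=> /e.
by rewrite /edge_ok !gP !ffunE.
Qed.

Definition representable (V : finType) (r : rel V) (S : {set V}) u v : Prop :=
  exists w, forall (G : graph) (a b : G), phoms r S u v a b = ev w a b.

Section Representable.
Variables (V : finType).
Implicit Types (r : rel V) (S : {set V}).

Lemma representable_eq r1 r2 S u v :
  {in S &, r1 =2 r2} -> representable r1 S u v -> representable r2 S u v.
Proof.
by move=> r12 [w wP]; exists w => G a b; rewrite -wP; apply/esym/phoms_eq.
Qed.

Lemma representable_glue r S1 S2 u v c :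
  (forall x y, x \in S1 :|: S2 -> y \in S1 :|: S2 -> r x y ->
     (x \in S1) && (y \in S1) || (x \in S2) && (y \in S2)) ->
  S1 :&: S2 = [set c] -> u \in S1 -> v \in S2 ->
  representable r S1 u c -> representable r S2 c v ->
  representable r (S1 :|: S2) u v.
Proof.
move=> nc S12 u1 v2 [w1 w1P] [w2 w2P]; exists (WMul w1 w2) => G a b /=.
rewrite (phoms_glue _ _ nc S12 u1 v2).
by apply: eq_bigr => d _; rewrite w1P w2P.
Qed.

Lemma representable_disjoint r S1 S2 u v :
  (forall x y, x \in S1 :|: S2 -> y \in S1 :|: S2 -> r x y ->
     (x \in S1) && (y \in S1) || (x \in S2) && (y \in S2)) ->
  [disjoint S1 & S2] -> u \in S1 -> v \in S2 ->
  representable r S1 u u -> representable r S2 v v ->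
  representable r (S1 :|: S2) u v.
Proof.
move=> nc dis u1 v2 [w1 w1P] [w2 w2P].
(* [w1] and [w2] denote diagonal matrices; the all-ones matrix between them yields the products of
   all pairs of diagonal entries. *)
exists (WMul w1 (WMul WJ w2)) => G a b /=.
rewrite (phoms_disjoint _ _ nc dis u1 v2) (bigD1 a) //= (bigD1 b) //= mul1n.
rewrite -w1P -w2P !big1 ?addn0 // => c nc'.
  by rewrite -w1P phoms_diag_neq // eq_sym.
by rewrite mul1n -w2P phoms_diag_neq.
Qed.

Lemma representable_diag r S u w : w \in S ->
  representable r S u w -> representable r S u u.
Proof.
(* Multiplication by the all-ones matrix takes row sums, which frees the image of [w]; [WI] then
   keeps the diagonal. *)
move=> wS [x xP]; exists (WI (WMul x WJ)) => G a b /=.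
have [<-|nab] := eqVneq a b; last by rewrite phoms_diag_neq.
rewrite mul1n (phoms_diag_sum _ _ _ wS).
by apply: eq_bigr => d _; rewrite muln1 xP.
Qed.

Lemma representable_set1 r u : irreflexive r -> representable r [set u] u u.
Proof.
by move=> ri; exists (WI WJ) => G a b; rewrite phoms_set1 //= muln1.
Qed.

Definition del_edge r u v : rel V := fun x y => r x y && ~~ pair_rel u v x y.

Lemma del_edge_sym r u v : symmetric r -> symmetric (del_edge r u v).
Proof. by move=> rs x y; rewrite /del_edge rs pair_rel_sym. Qed.

Lemma representable_del r S u v : symmetric r ->
  representable (del_edge r u v) S u v -> representable r S u v.
Proof.
move=> rs rep; have [ruv|nruv] := boolP (r u v).
  have [w wP] := rep; exists (WA w) => G a b /=.
  by rewrite (phoms_edge _ _ _ rs ruv) -wP.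
apply: representable_eq rep => x y _ _; rewrite /del_edge.
have [/orP[]/andP[/eqP-> /eqP->]|] := boolP (pair_rel u v x y); last by rewrite andbT.
  by rewrite (negPf nruv).
by rewrite rs (negPf nruv).
Qed.

End Representable.

Section Decomposition.
Variables (V : finType) (e : rel V).
Hypothesis e_sym : symmetric e.
Hypothesis e_irr : irreflexive e.
Implicit Types (r : rel V) (S : {set V}).

Definition outer r S : Prop :=
  ~ minor_in (complete 4) r S /\ ~ minor_in (complete_bipartite 2 3) r S.

Lemma outer_sub r1 r2 S1 S2 :
  {in S1 &, subrel r1 r2} -> S1 \subset S2 -> outer r2 S2 -> outer r1 S1.
Proof.
by move=> r12 sS [n1 n2]; split=> m; [apply: n1 | apply: n2];
  apply: minor_in_sub m.
Qed.

Definition add_edge r u v : rel V := fun x y => r x y || pair_rel u v x y.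

Lemma add_edge_sym r u v : symmetric r -> symmetric (add_edge r u v).
Proof. by move=> rs x y; rewrite /add_edge rs pair_rel_sym. Qed.

Definition nbr u : {set V} := [set x | e u x].

(* The hypothesis on a pair [(u, v)]: an outerplanar drawing in which [u] and
   [v] lie on the outer face even after a path of length 2 is attached to them. *)
Definition outer_pair S u v : Prop :=
  [/\ u \in S, v \in S, u != v, outer (add_edge e u v) S
    & ~ two_links e (S :\ u :\ v) (nbr u) (nbr v)].

(* Contracting [D] onto [c] turns the added edge [u v] into [u c]; a second
   pair of disjoint [u]-[c] links would give [K_(2,3)] with parts [{u}, {c}]. *)
Lemma outer_pair_contract S S1 R u v c :
  outer (add_edge e u v) S -> S1 \subset S -> c |: R \subset S ->
  conn e R -> v \in R -> (exists2 x, x \in R & e x c) ->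
  [disjoint S1 & R] -> u \in S1 -> c \in S1 -> u != c ->
  outer_pair S1 u c.
Proof.
move=> [n4 n23] sS1 sR cR vR [x xR exc] dis uS1 cS1 uc.
have as_ := @add_edge_sym e u v e_sym.
have sub_e B : {in B &, subrel e (add_edge e u v)} by move=> a b _ _; rewrite /add_edge => ->.
have cR' : conn (add_edge e u v) R by apply: conn_sub_rel cR; apply: sub_e.
have cD : conn (add_edge e u v) (c |: R).
  apply: (connU as_ (@conn1 _ _ c) cR' (set11 c) xR).
  by rewrite /add_edge e_sym exc !orbT.
have S1D : S1 :&: (c |: R) \subset [set c].
  apply/subsetP=> y; rewrite !inE => /andP[yS1 /orP[//|yR]].
  by rewrite (disjointFr dis yS1) in yR.
have step a b : a \in S1 -> b \in S1 -> add_edge e u c a b ->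
    [\/ add_edge e u v a b, a = c /\ exists2 d, d \in c |: R & add_edge e u v d b
      | b = c /\ exists2 d, d \in c |: R & add_edge e u v a d].
  move=> _ _ /orP[eab|/orP[]/andP[/eqP-> /eqP->]].
  - by constructor 1; rewrite /add_edge eab.
  - constructor 3; split=> //; exists v; first by rewrite setU1r.
    by rewrite /add_edge /pair_rel !eqxx orbT.
  - constructor 2; split=> //; exists v; first by rewrite setU1r.
    by rewrite /add_edge /pair_rel !eqxx !orbT.
have contr M := @minor_in_contract M V _ _ S1 S (c |: R) c as_ sS1 sR cD (setU11 _ _) S1D step.
split=> //; first by split=> /contr.
case=> Y [Z [[YK cY [yu yuN yuY] [yc ycN ycY]] [ZK cZ [zu zuN zuZ] [zc zcN zcZ]] dYZ]].
have sK : S1 :\ u :\ c \subset S1 by apply: subset_trans (subsetDl _ _) (subsetDl _ _).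
have YS1 := subset_trans YK sK; have ZS1 := subset_trans ZK sK.
have nK : (u \notin S1 :\ u :\ c) * (c \notin S1 :\ u :\ c).
  by rewrite !inE !eqxx /= andbF.
have uR : u \notin R by rewrite (disjointFr dis uS1).
have cRn : c \notin R by rewrite (disjointFr dis cS1).
have notin (B : {set V}) z : B \subset S1 :\ u :\ c -> z \notin S1 :\ u :\ c ->
    [disjoint [set z] & B].
  by move=> BK nz; rewrite disjoints1; apply: contra nz => /(subsetP BK).
rewrite !inE in yuN ycN zuN zcN.
apply: n23; apply: (@K23_minor _ _ as_ S [set u] [set c] Y Z R) => //.
- by rewrite sub1set (subsetP sS1).
- by rewrite sub1set (subsetP sS1).
- exact: subset_trans sS1.
- exact: subset_trans sS1.
- exact: subset_trans (subsetUr _ _) sR.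
- exact: conn1.
- exact: conn1.
- by apply: conn_sub_rel cY.
- by apply: conn_sub_rel cZ.
- by rewrite disjoints1 inE.
- by apply: notin; rewrite ?nK.
- by apply: notin; rewrite ?nK.
- by rewrite disjoints1.
- by apply: notin; rewrite ?nK.
- by apply: notin; rewrite ?nK.
- by rewrite disjoints1.
- by apply: disjointWl dis.
- by apply: disjointWl dis.
- by exists u, yu; rewrite set11 /add_edge yuN.
- by exists u, zu; rewrite set11 /add_edge zuN.
- by exists u, v; rewrite set11 /add_edge /pair_rel !eqxx orbT.
- by exists c, yc; rewrite set11 /add_edge ycN.
- by exists c, zc; rewrite set11 /add_edge zcN.
- by exists c, x; rewrite set11 /add_edge e_sym exc.
Qed.

(** As [u w] is an edge already, only two disjoint links have to be excluded. One of them, grown to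
    a maximal connected set that avoids the other, becomes adjacent to it, because the neighbours of
    [u] are connected without [u] and [w]. Together with [u] and [w] this is a [K_4]. *)
Lemma outer_pair_nonseparating S u w :
  outer e S -> u \in S -> w \in S -> e u w ->
  (forall x y, x \in (nbr u :&: S) :\ w -> y \in (nbr u :&: S) :\ w ->
     connect (restr e (S :\ u :\ w)) x y) ->
  outer_pair S u w.
Proof.
move=> outS uS wS euw cN.
have uw : u != w by apply: contraTneq euw => ->; rewrite e_irr.
split=> //.
  apply: outer_sub outS => // x y _ _ /orP[//|/orP[]/andP[/eqP-> /eqP->]] //.
  by rewrite e_sym.
case=> Y [Z [[YK cY [y yN yY] [yw ywN ywY]] [ZK cZ [z zN zZ] [zw zwN zwZ]] dYZ]].
set K := S :\ u :\ w in YK ZK cN.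
have sK : K \subset S by apply: subset_trans (subsetDl _ _) (subsetDl _ _).
have nK : (u \notin K) * (w \notin K) by rewrite !inE !eqxx /= andbF.
have inN x : x \in nbr u -> x \in K -> x \in (nbr u :&: S) :\ w.
  by rewrite !inE => -> /and3P[-> _ ->].
have yK := subsetP YK y yY; have zK := subsetP ZK z zZ.
have cyz := cN y z (inN y yN yK) (inN z zN zK).
have yKZ : y \in K :\: Z by rewrite inE yK (disjointFr dYZ yY).
pose Y' := component e (K :\: Z) y.
have Y'K : Y' \subset K :\: Z by apply: component_sub.
have Y'Z : [disjoint Y' & Z].
  apply: disjointWl Y'K _; rewrite -setI_eq0; apply/eqP/setP=> t.
  by rewrite !inE; case: (t \in Z); rewrite ?andbF.
have YY' : Y \subset Y'.
  apply: conn_sub_component cY _ yY; apply/subsetP=> t tY.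
  by rewrite inE (subsetP YK) // (disjointFr dYZ tY).
have [a [b [aK bK aY' nbY' eab]]] : exists a b, [/\ a \in K, b \in K, a \in Y', b \notin Y' & e a b].
  apply: (@connect_cut _ e K (mem Y') y z cyz); first exact: mem_component.
  by apply/negP=> /(disjointFr Y'Z); rewrite zZ.
have bZ : b \in Z.
  apply: contraNT nbY' => nbZ; apply: (component_closed yKZ aY' _ eab).
  by rewrite inE nbZ.
have Y'K' := subset_trans Y'K (subsetDl _ _).
have notin (B : {set V}) t : B \subset K -> t \notin K -> [disjoint [set t] & B].
  by move=> BK nt; rewrite disjoints1; apply: contra nt => /(subsetP BK).
rewrite !inE in yN ywN zN zwN.
case: outS => n4 _; apply: n4.
apply: (@K4_minor _ _ e_sym S [set u] [set w] Y' Z) => //.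
- by rewrite sub1set.
- by rewrite sub1set.
- exact: subset_trans sK.
- exact: subset_trans sK.
- exact: conn1.
- exact: conn1.
- exact: conn_component.
- by rewrite disjoints1 inE.
- by apply: notin; rewrite ?nK.
- by apply: notin; rewrite ?nK.
- by apply: notin; rewrite ?nK.
- by apply: notin; rewrite ?nK.
- by exists u, w; rewrite !set11.
- by exists u, y; rewrite set11 yN (subsetP YY').
- by exists u, z; rewrite set11.
- by exists w, yw; rewrite set11 (subsetP YY').
- by exists w, zw; rewrite set11.
- by exists a, b.
Qed.

(** The two claims need each other: a disconnected pair splits into smaller diagonal counts, and a
    diagonal count at a vertex with connected remainder becomes a pair on the same set [S]. Hence
    the claim on pairs, [Q], is settled first for each [S]. *)
Lemma decomposition n S : #|S| <= n ->
  (forall u, u \in S -> outer e S -> representable e S u u) /\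
  (forall u v, outer_pair S u v -> representable e S u v).
Proof.
elim: n S => [|n IH] S Sn.
  move: Sn; rewrite leqn0 cards_eq0 => /eqP S0.
  split=> [u|u v []]; by rewrite S0 inE.
have diag S' u : #|S'| <= n -> u \in S' -> outer e S' -> representable e S' u u.
  by move=> /IH[h _]; apply: h.
have pair S' u v : #|S'| <= n -> outer_pair S' u v -> representable e S' u v.
  by move=> /IH[_ h]; apply: h.
have small (S' : {set V}) x : S' \subset S -> x \in S -> x \notin S' -> #|S'| <= n.
  move=> sS xS nx; rewrite -ltnS; apply: leq_trans Sn.
  by apply: proper_card; apply/properP; split=> //; exists x.
have sube u v B : {in B &, subrel e (add_edge e u v)} by move=> a b _ _; rewrite /add_edge => ->.
have Q u v : outer_pair S u v -> representable e S u v.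
  move=> [uS vS uv outS nYZ].
  apply: representable_del => //; set r := del_edge e u v.
  have rs : symmetric r by apply: del_edge_sym.
  have re x y : r x y -> e x y by case/andP.
  (* Each part of the splittings below lacks [u] or [v], so the deleted edge is invisible there and
     the induction hypothesis for [e] applies. *)
  have r_eq (S' : {set V}) : (u \notin S') || (v \notin S') -> {in S' &, e =2 r}.
    move=> nuv x y xS yS; rewrite /r /del_edge.
    have [|_] := boolP (pair_rel u v x y); last by rewrite andbT.
    by case/orP=> /andP[/eqP xx /eqP yy]; move: nuv; rewrite -xx -yy xS yS.
  have nruv : ~~ r u v by rewrite /r /del_edge /pair_rel !eqxx andbF.
  have [cuv|ncuv] := boolP (v \in component r S u); last first.
    set S1 := component r S u in ncuv *.
    have sS1 : S1 \subset S by apply: component_sub.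
    have uS1 : u \in S1 by apply: mem_component.
    have SE : S1 :|: (S :\: S1) = S by rewrite -[RHS](setID S S1) (setIidPr sS1).
    have vS2 : v \in S :\: S1 by rewrite inE ncuv.
    have uS2 : u \notin S :\: S1 by rewrite inE uS1.
    rewrite -SE; apply: representable_disjoint => //.
    - rewrite SE => x y xS yS rxy; rewrite !in_setD xS yS !andbT.
      have [x1|nx1] := boolP (x \in S1); first by have -> : y \in S1 by apply: component_closed uS x1 yS rxy.
      have [y1|ny1] := boolP (y \in S1) => //.
      by case/negP: nx1; apply: (component_closed uS y1 xS); rewrite rs.
    - by rewrite -setI_eq0 setIDA setIC -setIDA setDv setI0.
    - apply: representable_eq (r_eq S1 _) _; first by rewrite ncuv orbT.
      apply: diag => //; first exact: (small _ v).
      by apply: outer_sub outS.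
    - apply: representable_eq (r_eq _ _) _; first by rewrite uS2.
      apply: diag => //; first by apply: (small _ u) => //; apply: subsetDl.
      by apply: outer_sub outS => //; apply: subsetDl.
  set K := S :\ u :\ v.
  case: (menger2 e_sym K (nbr u) (nbr v)) => [nl|[c cK nl]|//].
    case/negP: nl; have /existsP[a /andP[/setIP[aN aK] /existsP[b /andP[/setIP[bN bK] cab]]]] :=
      connect_linked rs uS vS uv nruv cuv.
    rewrite !inE in aN bN.
    apply/existsP; exists a; rewrite !inE (re _ _ aN); move: aK; rewrite !inE => -> /=.
    apply/existsP; exists b; rewrite !inE (re _ _ bN); move: bK; rewrite !inE => -> /=.
    by apply: connect_restr_sub cab => // x y _ _; apply: re.
  have /and3P[cv cu cS] : [&& c != v, c != u & c \in S] by move: cK; rewrite !inE.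
  set S0 := S :\ c.
  have sS0 : S0 \subset S by apply: subsetDl.
  have uS0 : u \in S0 by rewrite !inE eq_sym cu.
  have vS0 : v \in S0 by rewrite !inE eq_sym cv.
  set Ru := component r S0 u; set Rv := component r S0 v.
  have uRu : u \in Ru by apply: mem_component.
  have vRv : v \in Rv by apply: mem_component.
  have sRu : Ru \subset S0 by apply: component_sub.
  have sRv : Rv \subset S0 by apply: component_sub.
  have cs := sym_connect_sym (restr_sym S0 rs).
  have vRu : v \notin Ru.
    apply: contra nl => cuv0.
    have /existsP[a /andP[/setIP[aN aK] /existsP[b /andP[/setIP[bN bK] cab]]]] :=
      connect_linked rs uS0 vS0 uv nruv cuv0.
    have EK : S0 :\ u :\ v = K :\ c.
      by apply/setP=> x; rewrite !inE; case: (x == c); case: (x == u); case: (x == v).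
    rewrite EK in aK bK cab; rewrite !inE in aN bN.
    apply/existsP; exists a; rewrite !inE (re _ _ aN); move: aK; rewrite !inE => -> /=.
    apply/existsP; exists b; rewrite !inE (re _ _ bN); move: bK; rewrite !inE => -> /=.
    by apply: connect_restr_sub cab => // x y _ _; apply: re.
  have dR : [disjoint Ru & Rv].
    apply/pred0P=> x /=; apply/negbTE/negP=> /andP[]; rewrite !inE => xu.
    by rewrite cs => xv; case/negP: vRu; rewrite inE (connect_trans xu).
  have cRu : c \notin Ru by apply/negP=> /(subsetP sRu); rewrite !inE eqxx.
  have cRv : c \notin Rv by apply/negP=> /(subsetP sRv); rewrite !inE eqxx.
  have exit p x y : p \in S0 -> x \in component r S0 p -> y \in S ->
      y \notin component r S0 p -> r x y -> y = c.
    move=> pS0 xR yS nyR rxy; apply/eqP; apply: contraNT nyR => yc.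
    by apply: (component_closed pS0 xR _ rxy); rewrite !inE yc.
  have touch p q : p \in S0 -> q \notin component r S0 p -> connect (restr r S) p q ->
      exists2 x, x \in component r S0 p & e x c.
    move=> pS0 nq cpq.
    have [x [y [xS yS xR nyR rxy]]] := @connect_cut _ _ _
       (mem (component r S0 p)) p q cpq (mem_component _ _ _) nq.
    by exists x => //; apply: re; rewrite -(exit p x y).
  have tu : exists2 x, x \in Ru & e x c.
    by apply: (touch u v) => //; move: cuv; rewrite inE.
  have tv : exists2 x, x \in Rv & e x c.
    apply: (touch v u) => //; first by rewrite (disjointFr dR uRu).
    by rewrite (sym_connect_sym (restr_sym S rs)); move: cuv; rewrite inE.
  have cRuS : c |: Ru \subset S by rewrite subUset sub1set cS (subset_trans sRu).
  have cRvS : c |: Rv \subset S by rewrite subUset sub1set cS (subset_trans sRv).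
  have S12 : (c |: Ru) :|: (S :\: Ru) = S.
    apply/setP=> x; rewrite in_setU in_setU1 in_setD.
    have [->|xc] := eqVneq x c; first by rewrite cS.
    have [xR|//] := boolP (x \in Ru).
    by rewrite (subsetP (subset_trans sRu sS0)).
  have cRe p : p \in S0 -> conn e (component r S0 p).
    move=> pS0; apply: conn_sub_rel (conn_component rs pS0) => x y _ _; exact: re.
  (* The part of [v] is all of [S] outside [Ru], so it also receives [c] and the components of [S0]
     that contain neither [u] nor [v]. *)
  rewrite -S12; apply: (@representable_glue _ _ _ _ _ _ c).
  - rewrite S12 => x y xS yS rxy; rewrite !in_setU1 !in_setD xS yS !andbT.
    have [xR|nxR] := boolP (x \in Ru); have [yR|nyR] := boolP (y \in Ru); rewrite ?orbT //=.
      by rewrite (exit u x y) // eqxx.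
    by rewrite (exit u y x) ?eqxx // rs.
  - apply/setP=> x; rewrite in_setI in_setU1 in_setD in_set1.
    have [->|xc] := eqVneq x c; first by rewrite cRu cS.
    by case: (x \in Ru).
  - by rewrite setU1r.
  - by rewrite in_setD vRu.
  - have nv1 : v \notin c |: Ru by rewrite in_setU1 negb_or eq_sym cv.
    apply: representable_eq (r_eq _ _) _; first by rewrite nv1 orbT.
    apply: pair; first exact: (small _ v).
    apply: (@outer_pair_contract S _ Rv u v c) => //; rewrite ?setU11 ?setU1r //.
    + exact: cRe.
    + by rewrite -setI_eq0 setIUl setU_eq0 !setI_eq0 disjoints1 cRv.
    + by rewrite eq_sym.
  - have nu2 : u \notin S :\: Ru by rewrite in_setD uRu.
    apply: representable_eq (r_eq _ _) _; first by rewrite nu2.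
    apply: pair; first by apply: (small _ u) => //; apply: subsetDl.
    have op : outer_pair (S :\: Ru) v c.
      apply: (@outer_pair_contract S _ Ru v u c) => //; rewrite ?subsetDl ?in_setD ?vRu ?cRu //.
      + apply: outer_sub outS => // x y _ _; rewrite /add_edge /pair_rel orbC.
        by case/orP=> [/orP[]|->//] ->; rewrite ?orbT.
      + exact: cRe.
      + by rewrite -setI_eq0 setIC setIDA [Ru :&: S]setIC -setIDA setDv setI0.
      + by rewrite eq_sym.
    (* The contraction yields the pair in the order [v], [c]; only the order of the two vertices is
       exchanged here. *)
    case: op => h1 h2 h3 h4 h5; split=> //.
      apply: outer_sub h4 => // x y _ _; rewrite /add_edge /pair_rel.
      by case/orP=> [->//|/orP[]] ->; rewrite ?orbT.
    case=> Y [Z [[YK cY mY1 mY2] [ZK cZ mZ1 mZ2] dYZ]]; apply: h5.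
    have EK : S :\: Ru :\ v :\ c = S :\: Ru :\ c :\ v.
      by apply/setP=> x; rewrite !inE; case: (x == c); case: (x == v).
    by exists Y, Z; rewrite EK.
split=> // u uS outS.
have [SE|nSE] := eqVneq S [set u]; first by rewrite SE; apply: representable_set1.
have [/existsP[m /andP[mS eum]]|nn] := boolP [exists m, (m \in S) && e u m]; last first.
  have /subsetPn[z zS zu] : ~~ (S \subset [set u]).
    by apply: contra nSE => h; rewrite eqEsubset h sub1set.
  rewrite inE in zu.
  (* With [u] isolated, the images of [u] and of any other vertex [z] are prescribed together, as
     for a disjoint union; summing over the image of [z] gives the diagonal count. *)
  apply: (@representable_diag _ _ _ _ z) => //.
  have SE : [set u] :|: (S :\ u) = S by apply: setD1K.
  rewrite -SE; apply: representable_disjoint.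
  - rewrite SE => x y xS yS exy; rewrite !inE xS yS !andbT.
    have ne t : t \in S -> ~~ e u t.
      by move=> tS; apply: contra nn => eut; apply/existsP; exists t; rewrite tS.
    have [xu|] := eqVneq x u; first by move: exy; rewrite xu (negPf (ne y yS)).
    by have [yu|//] := eqVneq y u; move: exy; rewrite yu e_sym (negPf (ne x xS)).
  - by rewrite disjoints1 !inE eqxx.
  - exact: set11.
  - by rewrite !inE zu.
  - exact: representable_set1.
  - apply: diag; rewrite ?inE ?zu //; last by apply: outer_sub outS => //; apply: subsetDl.
    by apply: (small _ u) => //; rewrite ?subsetDl // !inE eqxx.
have mu : m != u by apply: contraTneq eum => ->; rewrite e_irr.
have mSu : m \in S :\ u by rewrite !inE mu.
set K := component e (S :\ u) m.
have sK : K \subset S :\ u by apply: component_sub.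
have uK : u \notin K by apply/negP=> /(subsetP sK); rewrite !inE eqxx.
have sKS := subset_trans sK (subsetDl _ _).
have mK : m \in K by apply: mem_component.
have cK : conn e K by apply: conn_component.
have SE : (u |: K) :|: (S :\: K) = S.
  apply/setP=> x; rewrite in_setU in_setU1 in_setD.
  have [->|xu] := eqVneq x u; first by rewrite uS.
  have [xK|//] := boolP (x \in K).
  by rewrite (subsetP sKS).
(* If [u] and [K] do not exhaust [S], then [u] separates [K] from the rest, and the diagonal matrix
   is the product of two diagonal matrices of smaller graphs. *)
have [KS|nKS] := eqVneq (u |: K) S; last first.
  have sUK : u |: K \subset S by rewrite subUset sub1set uS.
  have /subsetPn[z zS zK] : ~~ (S \subset u |: K).
    by apply: contra nKS => h; rewrite eqEsubset h sUK.
  rewrite -SE; apply: (@representable_glue _ _ _ _ _ _ u).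
  - rewrite SE => x y xS yS exy; rewrite !in_setU1 !in_setD xS yS !andbT.
    have cl a b : a \in K -> b \in S -> e a b -> (b == u) || (b \in K).
      move=> aK bS eab; have [//|bu] := eqVneq b u.
      by apply: (component_closed mSu aK _ eab); rewrite !inE bu.
    have [xK|nxK] := boolP (x \in K); first by rewrite ?(cl x y) ?orbT.
    have [yK|nyK] := boolP (y \in K); last by rewrite orbT.
    by rewrite orbF /= orbT andbT; have := cl y x yK xS; rewrite e_sym exy (negPf nxK) orbF; apply.
  - apply/setP=> x; rewrite in_setI in_setU1 in_setD in_set1.
    have [->|xu] := eqVneq x u; first by rewrite uK uS.
    by case: (x \in K).
  - exact: setU11.
  - by rewrite in_setD uK.
  - apply: diag; rewrite ?setU11 //; first exact: (small _ z).
    exact: outer_sub outS.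
  - apply: diag; rewrite ?in_setD ?uK //.
      by apply: (small _ m) => //; rewrite ?subsetDl // in_setD mK.
    by apply: outer_sub outS => //; apply: subsetDl.
have SuK : S :\ u = K by rewrite -KS setU1K.
have NK : nbr u :&: S \subset K.
  rewrite -SuK; apply/subsetP=> x; rewrite !inE => /andP[eux ->]; rewrite andbT.
  by apply: contraTneq eux => ->; rewrite e_irr.
have mN : m \in nbr u :&: S by rewrite !inE eum.
have [w wN wP] := nonseparating_vertex e_sym cK NK mN.
have [euw wS] : e u w /\ w \in S by move: wN; rewrite !inE => /andP[].
apply: (representable_diag wS); apply: Q; apply: outer_pair_nonseparating => //.
by rewrite SuK.
Qed.

End Decomposition.

(** The empty graph is an exception: it always has one homomorphism, whereas every word has sum 0
    over an empty target. *)
Lemma hom_eq_soe (F : graph) : outerplanar F -> irreflexive (@edge F) ->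
  (exists w, forall G : graph, hom F G = soe G w) \/ (forall G : graph, hom F G = 1).
Proof.
move=> [n4 n23] irr.
case: (pickP F) => [u _|F0].
  have out : outer (@edge F) setT by split=> /minorE.
  have [h _] := @decomposition _ _ (@edge_sym F) irr _ setT (leqnn _).
  have [w wP] := h u (in_setT u) out.
  left; exists w => G; rewrite (hom_phoms G u) /soe.
  by apply: eq_bigr => a _; apply: eq_bigr => b _.
right=> G.
rewrite /hom (_ : [set f | _] = setT).
  rewrite cardsT card_ffun (_ : #|F| = 0) //; exact: eq_card0.
by apply/setP=> f; rewrite !inE; apply/forallP=> x; have := F0 x.
Qed.

Lemma hom_loop (F : graph) (G : sgraph) x : @edge F x x -> hom F G = 0.
Proof.
move=> exx; apply/eqP; rewrite cards_eq0; apply/eqP/setP=> f; rewrite !inE.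
apply/negP=> /forallP/(_ x)/forallP/(_ x)/implyP/(_ exx).
by rewrite edge_irrefl.
Qed.

Theorem hom_equiv_outerplanarE (G H : sgraph) :
  hom_equiv outerplanar G H <-> forall w, soe G w = soe H w.
Proof.
split=> [GH w|GH F outF].
  by rewrite -!hom_wgraph; apply: GH; apply: wgraph_outerplanar.
have [/existsP[x exx]|nl] := boolP [exists x : F, edge x x].
  by rewrite !(hom_loop _ exx).
have irr : irreflexive (@edge F).
  by move=> x; apply/negbTE; apply: contra nl => exx; apply/existsP; exists x.
by case: (hom_eq_soe outF irr) => [[w wP]|h]; rewrite ?wP ?h.
Qed.

Import Order.TTheory GRing.Theory Num.Theory.
Local Open Scope ring_scope.

(** * From a Lasserre solution to words *)

Section QuadraticForms.
Variable R : realType.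

Definition qform (I : finType) (M : I -> I -> R) (z : I -> R) : R :=
  \sum_a \sum_b z a * z b * M a b.

(** Along the line of the [t z + e_b] the form is affine in [t] with slope twice the desired sum;
    being nonnegative for all [t], it has slope 0. *)
Lemma qform_kernel (I : finType) (M : I -> I -> R) (z : I -> R) b :
  (forall a c, M a c = M c a) -> (forall w, 0 <= qform M w) ->
  qform M z = 0 -> \sum_a z a * M a b = 0.
Proof.
move=> Ms psd z0; set c := \sum_a _.
pose w t a := t * z a + (a == b)%:R.
have E t : qform M (w t) = 2 * t * c + M b b.
  have -> : qform M (w t) = t ^+ 2 * qform M z + t * c + t * c + M b b.
    have D1 : \sum_a \sum_d (a == b)%:R * (d == b)%:R * M a d = M b b.
      rewrite (bigD1 b) //= (bigD1 b) //= eqxx !mul1r !big1 ?addr0 //.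
        by move=> a /negPf ab; apply: big1 => d _; rewrite ab !mul0r.
      by move=> d /negPf db; rewrite db mulr0 mul0r.
    have D2 : \sum_a \sum_d z a * (d == b)%:R * M a d = c.
      apply: eq_bigr => a _; rewrite (bigD1 b) //= eqxx mulr1 big1 ?addr0 //.
      by move=> d /negPf db; rewrite db mulr0 mul0r.
    have D3 : \sum_a \sum_d (a == b)%:R * z d * M a d = c.
      rewrite exchange_big -[RHS]D2; apply: eq_bigr => d _; apply: eq_bigr => a _.
      by rewrite Ms; ring.
    rewrite -D1 -{1}D2 -D3 /qform !mulr_sumr -!big_split; apply: eq_bigr => a _ /=.
    rewrite !mulr_sumr -!big_split; apply: eq_bigr => d _ /=.
    by rewrite /w; ring.
  by rewrite z0; ring.
apply/eqP; apply: contraT => c0.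
(* At this [t] the affine function takes the value -1. *)
have := psd (w (- (M b b + 1) / (2 * c))).
rewrite E (_ : 2 * _ * c = - (M b b + 1)); last by field.
by lra.
Qed.


Lemma sum_option (T : finType) (F : option T -> R) :
  \sum_a F a = F None + \sum_t F (Some t).
Proof.
rewrite (bigD1 None) //=; congr (_ + _).
by rewrite (reindex_omap Some id) //=; [apply: eq_bigl => t; rewrite eqxx | case].
Qed.

Lemma sum_pair (T1 T2 : finType) (F : T1 * T2 -> R) :
  \sum_a F a = \sum_x \sum_y F (x, y).
Proof. by rewrite pair_bigA; apply: eq_bigr => -[]. Qed.

(** Sets of size at most 1 are indexed by [option T], so the moment matrix becomes a kernel with
    [None] as the index of the empty set. *)
Definition small_set (T : finType) (a : option T) : {set T} :=
  if a is Some t then [set t] else set0.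

Lemma small_setP (T : finType) (I : {set T}) :
  I \in subsets_le T 1 -> small_set [pick t | t \in I] = I.
Proof.
rewrite inE; case: pickP => [t tI|I0] /= cI; last by apply/esym/setP=> t; rewrite I0 inE.
by apply/eqP; rewrite eqEcard sub1set tI cards1.
Qed.

Lemma small_setK (T : finType) (a : option T) : [pick t | t \in small_set a] = a.
Proof.
case: a => [t|] /=; last by case: pickP => // x; rewrite inE.
by case: pickP => [x /set1P->//|/(_ t)]; rewrite set11.
Qed.

Lemma mem_small_set (T : finType) (a : option T) : small_set a \in subsets_le T 1.
Proof. by rewrite inE; case: a => [t|]; rewrite /= ?cards1 ?cards0. Qed.

Lemma sum_subsets_le1 (T : finType) (F : {set T} -> R) :
  \sum_(i < #|subsets_le T 1|) F (enum_val i) = \sum_(a : option T) F (small_set a).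
Proof.
rewrite -big_enum_val.
rewrite (reindex_onto (@small_set T) (fun I => [pick t | t \in I])) /=; last by move=> I; apply: small_setP.
by apply: eq_bigl => a; rewrite mem_small_set small_setK eqxx.
Qed.

Lemma moment_mx_form (T : finType) (y : {set T} -> R) (z : option T -> R) :
  let v := \row_i z [pick t | t \in (enum_val i : {set T})] in
  (v *m moment_mx 1 y *m v^T) 0 0 = qform (fun a b => y (small_set a :|: small_set b)) z.
Proof.
move=> v; rewrite mxE.
transitivity (\sum_(j < #|subsets_le T 1|) \sum_(i < #|subsets_le T 1|)
   z [pick t | t \in (enum_val i : {set T})] * z [pick t | t \in (enum_val j : {set T})] *
   y (enum_val i :|: enum_val j)).
  apply: eq_bigr => j _; rewrite mxE mulr_suml; apply: eq_bigr => i _.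
  by rewrite !mxE; ring.
rewrite exchange_big (sum_subsets_le1 (fun I => \sum_(j < #|subsets_le T 1|)
   z [pick t | t \in I] * z [pick t | t \in (enum_val j : {set T})] * y (I :|: enum_val j))).
apply: eq_bigr => a _; rewrite small_setK.
rewrite (sum_subsets_le1 (fun J => z a * z [pick t | t \in J] * y (small_set a :|: J))).
by apply: eq_bigr => b _; rewrite small_setK.
Qed.

Lemma psdmx_moment (T : finType) (y : {set T} -> R) :
  psdmx (moment_mx 1 y) <->
  forall z : option T -> R, 0 <= qform (fun a b => y (small_set a :|: small_set b)) z.
Proof.
split=> [[_ psd] z|psd]; first by rewrite -moment_mx_form.
split; first by apply/matrixP=> i j; rewrite !mxE setUC.
move=> v; have m0 : small_set None \in subsets_le T 1 by apply: mem_small_set.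
pose z (a : option T) := v 0 (enum_rank_in m0 (small_set a)).
have := psd z; rewrite -moment_mx_form.
suff -> : \row_i z [pick t | t \in (enum_val i : {set T})] = v by [].
apply/rowP=> i; rewrite mxE /z small_setP ?enum_valK_in //.
exact: enum_valP.
Qed.

End QuadraticForms.

Section Coupling.
Variables (R : realType) (G H : sgraph).

Definition evR (G : graph) w (a b : G) : R := (ev w a b)%:R.

Variable p : G * H -> G * H -> R.
Hypothesis p_sym : forall a b, p a b = p b a.
Hypothesis p_psd : forall z, 0 <= qform p z.
Hypothesis p_row : forall g b, \sum_h p (g, h) b = p b b.
Hypothesis p_col : forall h b, \sum_g p (g, h) b = p b b.
Hypothesis p_row1 : forall g, \sum_h p (g, h) (g, h) = 1.
Hypothesis p_col1 : forall h, \sum_g p (g, h) (g, h) = 1.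
Hypothesis p_eq : forall g h g' h', (g == g') != (h == h') -> p (g, h) (g', h') = 0.
Hypothesis p_edge : forall g h g' h',
  edge g g' != edge h h' -> p (g, h) (g', h') = 0.

(* [p] as the Choi matrix of a linear map sending [X] to [Y], and its adjoint
   sending [Y] to [X]. *)
Definition transported (X : G -> G -> R) (Y : H -> H -> R) : Prop :=
  (forall h h', \sum_g \sum_g' X g g' * p (g, h) (g', h') = Y h h') /\
  (forall g g', \sum_h \sum_h' Y h h' * p (g, h) (g', h') = X g g').

Definition intertwined (X : G -> G -> R) (Y : H -> H -> R) : Prop :=
  forall g0 h0 b, \sum_g X g0 g * p (g, h0) b = \sum_h Y h h0 * p (g0, h) b.

(** The map with Choi matrix [p] is unital. [p_diag_row] says the same of its adjoint, which means
    that the map preserves traces. *)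
Lemma p_diag_col h h' : \sum_g p (g, h) (g, h') = (h == h')%:R.
Proof.
have [<-|nh] := eqVneq h h'; first exact: p_col1.
by apply: big1 => g _; apply: p_eq; rewrite eqxx (negPf nh).
Qed.

Lemma p_diag_row g g' : \sum_h p (g, h) (g', h) = (g == g')%:R.
Proof.
have [<-|ng] := eqVneq g g'; first exact: p_row1.
by apply: big1 => h _; apply: p_eq; rewrite eqxx (negPf ng).
Qed.

Lemma sum_delta (I : finType) (F : I -> R) j : \sum_i F i * (i == j)%:R = F j.
Proof.
rewrite (bigD1 j) //= eqxx mulr1 big1 ?addr0 // => i /negPf ij.
by rewrite ij mulr0.
Qed.

(** Summing the intertwining relation along a diagonal over [G] or over [H] turns one side into an
    image of [X] or [Y]; the other side collapses by unitality. *)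
Lemma intertwined_transported X Y : intertwined X Y -> transported X Y.
Proof.
move=> XY; split=> [h h'|g g'].
  transitivity (\sum_g \sum_k Y k h' * p (g, k) (g, h)).
    apply: eq_bigr => g _; rewrite -XY; apply: eq_bigr => g' _.
    by rewrite p_sym.
  rewrite exchange_big -[RHS](sum_delta (fun k => Y k h') h); apply: eq_bigr => k _.
  by rewrite -mulr_sumr p_diag_col.
rewrite exchange_big -[RHS](sum_delta (fun k => X g k) g').
transitivity (\sum_h' \sum_k X g k * p (k, h') (g', h')).
  by apply: eq_bigr => h' _; rewrite XY.
by rewrite exchange_big; apply: eq_bigr => k _; rewrite -mulr_sumr p_diag_row.
Qed.

(* The norm of [X p - p Y], with respect to [p], is [tr X^T X - tr Y^T Y = 0]. *)
Lemma transported_intertwined X Y : transported X Y -> intertwined X Y.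
Proof.
move=> [XY YX].
pose z g0 h0 (a : G * H) : R := X g0 a.1 * (a.2 == h0)%:R - Y a.2 h0 * (a.1 == g0)%:R.
have zsum g0 h0 (F : G * H -> R) : \sum_a z g0 h0 a * F a =
    \sum_g X g0 g * F (g, h0) - \sum_h Y h h0 * F (g0, h).
  rewrite sum_pair.
  transitivity (\sum_g \sum_h (X g0 g * F (g, h) * (h == h0)%:R)
     - \sum_g \sum_h (Y h h0 * F (g, h) * (g == g0)%:R)).
    rewrite -sumrB; apply: eq_bigr => g _; rewrite -sumrB; apply: eq_bigr => h _.
    by rewrite /z /=; ring.
  congr (_ - _); first by apply: eq_bigr => g _; rewrite sum_delta.
  by rewrite exchange_big; apply: eq_bigr => h _; rewrite sum_delta.
(* The square of [X p - p Y] expands into [t1], [t4] and twice the cross term [t2]. Summed over [g0]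
   and [h0], [t1] and [t4] give the squared norms of [X] and [Y] by the diagonal sums of [p], and
   [t2] pairs [Y] with the image of [X], that is, with itself. *)
pose t1 g0 h0 := \sum_g \sum_g' X g0 g * X g0 g' * p (g, h0) (g', h0).
pose t2 g0 h0 := \sum_g \sum_h X g0 g * Y h h0 * p (g0, h) (g, h0).
pose t4 g0 h0 := \sum_h \sum_h' Y h h0 * Y h' h0 * p (g0, h) (g0, h').
have qz g0 h0 : qform p (z g0 h0) = t1 g0 h0 - t2 g0 h0 - t2 g0 h0 + t4 g0 h0.
  transitivity (\sum_a z g0 h0 a * \sum_b z g0 h0 b * p a b).
    by apply: eq_bigr => a _; rewrite mulr_sumr; apply: eq_bigr => b _; rewrite mulrA.
  rewrite zsum.
  transitivity ((t1 g0 h0 - t2 g0 h0) - (t2 g0 h0 - t4 g0 h0)); last by ring.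
  congr (_ - _).
    rewrite /t1 /t2 -sumrB; apply: eq_bigr => g _; rewrite zsum mulrBr !mulr_sumr.
    by congr (_ - _); apply: eq_bigr => k _; rewrite mulrA // p_sym.
  rewrite /t2 exchange_big /t4 -sumrB; apply: eq_bigr => h _; rewrite zsum mulrBr !mulr_sumr.
  by congr (_ - _); apply: eq_bigr => k _; rewrite mulrA // [Y h h0 * _]mulrC.
have T1 : \sum_g0 \sum_h0 t1 g0 h0 = \sum_g \sum_g' X g g' * X g g'.
  apply: eq_bigr => g0 _; rewrite exchange_big; apply: eq_bigr => g _.
  rewrite exchange_big -[RHS](sum_delta (fun k => X g0 g * X g0 k) g); apply: eq_bigr => g' _.
  by rewrite -mulr_sumr p_diag_row eq_sym.
have T4 : \sum_g0 \sum_h0 t4 g0 h0 = \sum_h \sum_h' Y h h' * Y h h'.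
  rewrite exchange_big [RHS]exchange_big; apply: eq_bigr => h0 _.
  rewrite exchange_big; apply: eq_bigr => h _.
  rewrite exchange_big -[RHS](sum_delta (fun k => Y h h0 * Y k h0) h); apply: eq_bigr => h' _.
  by rewrite -mulr_sumr p_diag_col eq_sym.
have T2 : \sum_g0 \sum_h0 t2 g0 h0 = \sum_h \sum_h' Y h h' * Y h h'.
  transitivity (\sum_g \sum_h0 \sum_h \sum_g' Y h h0 * (X g g' * p (g, h) (g', h0))).
    apply: eq_bigr => g0 _; apply: eq_bigr => h0 _; rewrite exchange_big.
    by apply: eq_bigr => h _; apply: eq_bigr => g _; ring.
  rewrite exchange_big [RHS]exchange_big; apply: eq_bigr => h0 _.
  rewrite exchange_big; apply: eq_bigr => h _.
  rewrite -XY mulr_sumr; apply: eq_bigr => g _.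
  by rewrite mulr_sumr.
(* Both sides equal the pairing of [X] with [Y] through [p]; this is where both directions of
   [transported] enter. *)
have XXYY : \sum_g \sum_g' X g g' * X g g' = \sum_h \sum_h' Y h h' * Y h h'.
  transitivity (\sum_g \sum_g' \sum_h \sum_h' X g g' * (Y h h' * p (g, h) (g', h'))).
    apply: eq_bigr => g _; apply: eq_bigr => g' _; rewrite -{2}YX mulr_sumr.
    by apply: eq_bigr => h _; rewrite mulr_sumr.
  transitivity (\sum_h \sum_h' \sum_g \sum_g' X g g' * (Y h h' * p (g, h) (g', h'))).
    under eq_bigr => g _ do rewrite exchange_big /=.
    rewrite exchange_big; apply: eq_bigr => h _.
    under eq_bigr => g _ do rewrite exchange_big /=.
    by rewrite exchange_big.
  apply: eq_bigr => h _; apply: eq_bigr => h' _; rewrite -[W in _ = _ * W]XY mulr_sumr.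
  by apply: eq_bigr => g _; rewrite mulr_sumr; apply: eq_bigr => g' _; ring.
have tot : \sum_g0 \sum_h0 qform p (z g0 h0) = 0.
  transitivity (\sum_g0 \sum_h0 t1 g0 h0 - \sum_g0 \sum_h0 t2 g0 h0
     - \sum_g0 \sum_h0 t2 g0 h0 + \sum_g0 \sum_h0 t4 g0 h0); last first.
    by rewrite T1 T2 T4 XXYY; ring.
  rewrite -!sumrB -big_split; apply: eq_bigr => g0 _.
  rewrite -!sumrB -big_split; apply: eq_bigr => h0 _; exact: qz.
have q0 g0 h0 : qform p (z g0 h0) = 0.
  have sub0 g : \sum_h qform p (z g h) = 0.
    by apply: (psumr_eq0P _ tot) => // g1 _; apply: sumr_ge0.
  by apply: (psumr_eq0P _ (sub0 g0)).
move=> g0 h0 b; apply/eqP; rewrite -subr_eq0; apply/eqP.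
by rewrite -(zsum g0 h0 (fun a => p a b)); apply: qform_kernel.
Qed.

(** Intertwining relations can be composed, which settles products. For Schur products with the
    identity or the adjacency matrix, the entries over [G] and over [H] agree wherever [p] is
    nonzero. *)
Lemma transported_words w : transported (@evR G w) (@evR H w).
Proof.
elim: w => [|w1 IH1 w2 IH2|w [XY YX]|w [XY YX]].
- split=> [h h'|g g']; rewrite /evR /=.
    rewrite exchange_big -[RHS](p_col1 h'); apply: eq_bigr => g' _.
    by rewrite -[RHS](p_col h); apply: eq_bigr => g _; rewrite mul1r.
  rewrite exchange_big -[RHS](p_row1 g'); apply: eq_bigr => h' _.
  by rewrite -[RHS](p_row g); apply: eq_bigr => h _; rewrite mul1r.
- apply: intertwined_transported.
  have I1 := transported_intertwined IH1; have I2 := transported_intertwined IH2.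
  move=> g0 h0 b; rewrite /evR /=.
  transitivity (\sum_g1 \sum_g evR w1 g0 g1 * (evR w2 g1 g * p (g, h0) b)).
    rewrite exchange_big; apply: eq_bigr => g _; rewrite natr_sum mulr_suml.
    by apply: eq_bigr => g1 _; rewrite natrM mulrA.
  transitivity (\sum_h \sum_g1 evR w2 h h0 * (evR w1 g0 g1 * p (g1, h) b)).
    rewrite [RHS]exchange_big; apply: eq_bigr => g1 _; rewrite -mulr_sumr I2 mulr_sumr.
    by apply: eq_bigr => h _; ring.
  transitivity (\sum_h \sum_h1 evR w2 h h0 * (evR w1 h1 h * p (g0, h1) b)).
    by apply: eq_bigr => h _; rewrite -!mulr_sumr I1.
  rewrite exchange_big; apply: eq_bigr => h1 _; rewrite natr_sum mulr_suml.
  by apply: eq_bigr => h _; rewrite natrM /evR; ring.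
- have E g h g' h' : (g == g')%:R * p (g, h) (g', h') = (h == h')%:R * p (g, h) (g', h').
    have [->//|/p_eq->] := eqVneq (g == g') (h == h'); by rewrite !mulr0.
  split=> [h h'|g g']; rewrite /evR /= natrM.
    rewrite -/(evR w h h') -XY mulr_sumr; apply: eq_bigr => g _.
    rewrite mulr_sumr; apply: eq_bigr => g' _.
    by rewrite natrM -mulrA mulrCA E -/(evR w g g'); ring.
  rewrite -/(evR w g g') -YX mulr_sumr; apply: eq_bigr => h _.
  rewrite mulr_sumr; apply: eq_bigr => h' _.
  by rewrite natrM -mulrA mulrCA -E -/(evR w h h'); ring.
- have E g h g' h' : (edge g g')%:R * p (g, h) (g', h') = (edge h h')%:R * p (g, h) (g', h').
    have [->//|/p_edge->] := eqVneq (edge g g') (edge h h'); by rewrite !mulr0.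
  split=> [h h'|g g']; rewrite /evR /= natrM.
    rewrite -/(evR w h h') -XY mulr_sumr; apply: eq_bigr => g _.
    rewrite mulr_sumr; apply: eq_bigr => g' _.
    by rewrite natrM -mulrA mulrCA E -/(evR w g g'); ring.
  rewrite -/(evR w g g') -YX mulr_sumr; apply: eq_bigr => h _.
  rewrite mulr_sumr; apply: eq_bigr => h' _.
  by rewrite natrM -mulrA mulrCA -E -/(evR w h h'); ring.
Qed.

(** The adjoint sends the all-ones matrix to the all-ones matrix, so the map preserves sums of
    entries. *)
Lemma coupling_soe w : soe G w = soe H w.
Proof.
have [XY _] := transported_words w; have [J _] := transported_words WJ.
have [_ J'] := transported_words WJ.
apply/eqP; rewrite -(eqr_nat R); apply/eqP; rewrite /soe !natr_sum.
transitivity (\sum_g \sum_g' \sum_h \sum_h' evR w g g' * p (g, h) (g', h')).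
  apply: eq_bigr => g _; rewrite natr_sum; apply: eq_bigr => g' _.
  rewrite -[LHS]mulr1 -[X in _ * X](J' g g') mulr_sumr; apply: eq_bigr => h _.
  by rewrite mulr_sumr; apply: eq_bigr => h' _; rewrite mul1r.
transitivity (\sum_h \sum_h' \sum_g \sum_g' evR w g g' * p (g, h) (g', h')).
  under eq_bigr => g _ do rewrite exchange_big /=.
  rewrite exchange_big; apply: eq_bigr => h _.
  under eq_bigr => g _ do rewrite exchange_big /=.
  by rewrite exchange_big.
apply: eq_bigr => h _; rewrite natr_sum; apply: eq_bigr => h' _; exact: XY.
Qed.

End Coupling.

Lemma lasserre1_soe (R : realType) (G H : sgraph) w :
  lasserre1 R G H -> soe G w = soe H w.
Proof.
case=> y [/psdmx_moment psd row col iso norm].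
pose T := (G * H)%type.
pose q (a b : option T) := y (small_set a :|: small_set b).
have q_sym a b : q a b = q b a by rewrite /q setUC.
pose p (a b : T) := y [set a; b].
have pE a b : q (Some a) (Some b) = p a b by [].
have p_sym a b : p a b = p b a by rewrite -!pE q_sym.
have pd a : p a a = y [set a] by rewrite /p setUid.
have q0E a : q None (Some a) = p a a by rewrite /q /= set0U pd.
have p0 a b : ~~ partial_iso [set a; b] -> p a b = 0.
  move=> nab; apply: iso => //; rewrite inE cards2; by case: (a != b).
have p_eq g h g' h' : (g == g') != (h == h') -> p (g, h) (g', h') = 0.
  move=> ne; apply: p0; apply: contra ne => /forallP/(_ (g, h)).
  rewrite !inE eqxx => /forallP/(_ (g', h')); rewrite !inE eqxx orbT.
  by case/andP.
have p_edge g h g' h' : edge g g' != edge h h' -> p (g, h) (g', h') = 0.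
  move=> ne; apply: p0; apply: contra ne => /forallP/(_ (g, h)).
  rewrite !inE eqxx => /forallP/(_ (g', h')); rewrite !inE eqxx orbT.
  by case/andP.
(* The indicator of the empty set minus the indicator of [S] is a null vector of the moment matrix:
   the form has value 1 - 2 + 1. [qform_kernel] turns this into a linear relation between the rows;
   [S] will be a row or a column of pairs. *)
have kernel (S : pred T) : \sum_(a | S a) p a a = 1 ->
    (forall a b, S a -> S b -> a != b -> p a b = 0) ->
    forall b, \sum_(a | S a) p a b = p b b.
  move=> S1 S0 b.
  pose z (a : option T) : R := if a is Some t then - (S t)%:R else 1.
  have zsum F : \sum_a z a * F a = F None - \sum_(t | S t) F (Some t).
    rewrite sum_option /= mul1r; congr (_ + _); rewrite -sumrN [RHS]big_mkcond.
    by apply: eq_bigr => t _; case: (S t); rewrite ?mulN1r // oppr0 mul0r.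
  have qz : qform q z = 0.
    transitivity (\sum_a z a * \sum_b z b * q a b).
      by apply: eq_bigr => a _; rewrite mulr_sumr; apply: eq_bigr => c _; rewrite mulrA.
    rewrite !zsum.
    have -> : q None None = 1 by rewrite /q /= setU0 norm.
    under eq_bigr => t _ do rewrite q0E.
    rewrite S1 subrr sub0r; apply/eqP; rewrite oppr_eq0; apply/eqP.
    apply: big1 => t St; rewrite zsum q_sym q0E (bigD1 t) //= pE big1 ?addr0 ?subrr //.
    by move=> t' /andP[St' t't]; rewrite pE S0 // eq_sym.
  have := qform_kernel (Some b) q_sym psd qz.
  by rewrite zsum q0E => /eqP; rewrite subr_eq0 => /eqP->.
have row1 g : \sum_h p (g, h) (g, h) = 1.
  by under eq_bigr => h _ do rewrite pd; rewrite row.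
have col1 h : \sum_g p (g, h) (g, h) = 1.
  by under eq_bigr => g _ do rewrite pd; rewrite col.
have rowE g (F : T -> R) : \sum_(a : T | a.1 == g) F a = \sum_h F (g, h).
  rewrite (reindex_onto (fun h => (g, h)) snd) /=; last by case=> g' h /= /eqP->.
  by apply: eq_bigl => h; rewrite !eqxx.
have colE h (F : T -> R) : \sum_(a : T | a.2 == h) F a = \sum_g F (g, h).
  rewrite (reindex_onto (fun g => (g, h)) fst) /=; last by case=> g h' /= /eqP->.
  by apply: eq_bigl => g; rewrite !eqxx.
apply: (coupling_soe (p := p)) => //.
- move=> z; have := psd (fun a => if a is Some t then z t else 0).
  rewrite /qform sum_option big1 ?add0r; last by move=> a _; rewrite !mul0r.
  congr (_ <= _); apply: eq_bigr => a _.
  by rewrite sum_option mulr0 mul0r add0r.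
- move=> g b; rewrite -(rowE g (fun a => p a b)); apply: kernel; first by rewrite rowE.
  case=> g1 h1 [g2 h2] /= /eqP-> /eqP-> ne; apply: p_eq.
  by apply: contra ne; rewrite eqxx eq_sym eqb_id => /eqP->.
- move=> h b; rewrite -(colE h (fun a => p a b)); apply: kernel; first by rewrite colE.
  case=> g1 h1 [g2 h2] /= /eqP-> /eqP-> ne; apply: p_eq.
  by apply: contra ne; rewrite eqxx eqb_id => /eqP->.
Qed.

(** * From words to a Lasserre solution *)

Section PositiveSemidefinite.
Variable R : realType.

Lemma row_norm_ge0 n (w : 'rV[R]_n) : 0 <= (w *m w^T) 0 0.
Proof. by rewrite mxE; apply: sumr_ge0 => i _; rewrite mxE -expr2 sqr_ge0. Qed.

Lemma row_norm_eq0 n (w : 'rV[R]_n) : (w *m w^T) 0 0 = 0 -> w = 0.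
Proof.
rewrite mxE => w0; apply/rowP=> i; rewrite mxE.
have pos j : true -> 0 <= w 0 j * w^T j 0 by rewrite mxE -expr2 sqr_ge0.
by have /eqP := psumr_eq0P pos w0 (i := i) isT; rewrite mxE -expr2 sqrf_eq0 => /eqP.
Qed.

(* The Gram matrix [c] is invertible and commutes with [P], so that
   [P = P c^-1 P]. *)
Lemma psd_of_square n k (P : 'M[R]_n) (K : nat -> 'M[R]_n) (al : nat -> R) :
  P^T = P -> P *m P = (\sum_(i < k) K i *m (K i)^T) *m P ->
  \sum_(i < k) al i *: K i = 1%:M ->
  forall v : 'rV_n, 0 <= (v *m P *m v^T) 0 0.
Proof.
move=> Ps; set c := \sum_(i < k) _ => PP K1 v.
have cs : c^T = c.
  by rewrite /c raddf_sum; apply: eq_bigr => i _ /=; rewrite trmx_mul trmxK.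
have cform (w : 'rV_n) : (w *m c *m w^T) 0 0 =
    \sum_(i < k) ((w *m K i) *m (w *m K i)^T) 0 0.
  rewrite /c mulmx_sumr mulmx_suml summxE; apply: eq_bigr => i _.
  by rewrite trmx_mul !mulmxA.
(* [w c = 0] makes the sum of the squared norms of the [w K_i] vanish; so every [w K_i] is 0, and
   with them [w], as the identity is a combination of the [K_i]. *)
have cu : c \in unitmx.
  rewrite -row_free_unit; apply: inj_row_free => w wc.
  have := cform w; rewrite wc mul0mx [LHS]mxE => /esym w0.
  have wK i : (i < k)%N -> w *m K i = 0.
    move=> ik; apply: row_norm_eq0.
    have pos (j : 'I_k) : true -> 0 <= ((w *m K j) *m (w *m K j)^T) 0 0.
      by move=> _; apply: row_norm_ge0.
    exact: (psumr_eq0P pos w0 (i := Ordinal ik) isT).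
  rewrite -[w]mulmx1 -K1 mulmx_sumr big1 // => i _.
  by rewrite -scalemxAr wK ?scaler0.
have Pc : P *m c = P *m P by rewrite -[LHS]trmxK trmx_mul cs Ps -PP trmx_mul Ps.
have [z ->] : exists z, v = z *m c by exists (v *m invmx c); rewrite mulmxKV.
have -> : z *m c *m P *m (z *m c)^T = z *m (c *m P *m c) *m z^T.
  by rewrite trmx_mul cs !mulmxA.
have -> : c *m P *m c = P *m c *m P by rewrite -[LHS]mulmxA Pc mulmxA -PP.
have -> : z *m (P *m c *m P) *m z^T = (z *m P) *m c *m (z *m P)^T.
  by rewrite trmx_mul Ps !mulmxA.
by rewrite cform; apply: sumr_ge0 => i _; apply: row_norm_ge0.
Qed.

End PositiveSemidefinite.

Section FunctionMatrix.
Variables (R : realType) (I : finType).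

Definition fun_mx (f : I -> I -> R) : 'M[R]_#|I| :=
  \matrix_(i, j) f (enum_val i) (enum_val j).

Lemma sum_enum_val (F : I -> R) : \sum_(i < #|I|) F (enum_val i) = \sum_x F x.
Proof. by rewrite -big_enum_val; apply: eq_bigl. Qed.

Lemma fun_mx_mul f g :
  fun_mx f *m fun_mx g = fun_mx (fun a b => \sum_c f a c * g c b).
Proof.
apply/matrixP=> i j; rewrite !mxE -(sum_enum_val (fun c => f _ c * g c _)).
by apply: eq_bigr => k _; rewrite !mxE.
Qed.

Lemma fun_mx_form f z :
  let v := \row_i z (enum_val i) in (v *m fun_mx f *m v^T) 0 0 = qform f z.
Proof.
move=> v; rewrite mxE /qform exchange_big -sum_enum_val; apply: eq_bigr => j _.
rewrite !mxE -(sum_enum_val (fun a => z a * _ * _)) mulr_suml.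
by apply: eq_bigr => i _; rewrite !mxE; ring.
Qed.

End FunctionMatrix.

Section Inner.
Variables (R : realType) (I : finType).
Implicit Types X : I -> I -> R.

Definition ip X X' : R := \sum_a \sum_b X a b * X' a b.

Lemma ipC X X' : ip X X' = ip X' X.
Proof. by apply: eq_bigr => a _; apply: eq_bigr => b _; rewrite mulrC. Qed.

Lemma ip_linearl k (c : nat -> R) X X' (Z : nat -> I -> I -> R) :
  ip (fun a b => X a b - \sum_(i < k) c i * Z i a b) X' =
  ip X X' - \sum_(i < k) c i * ip (Z i) X'.
Proof.
have -> : \sum_(i < k) c i * ip (Z i) X' =
    \sum_a \sum_b (\sum_(i < k) c i * Z i a b) * X' a b.
  under eq_bigr => i _ do rewrite mulr_sumr.
  rewrite exchange_big; apply: eq_bigr => a _.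
  under eq_bigr => i _ do rewrite mulr_sumr.
  rewrite exchange_big; apply: eq_bigr => b _.
  by rewrite mulr_suml; apply: eq_bigr => i _; rewrite mulrA.
rewrite /ip -sumrB; apply: eq_bigr => a _; rewrite -sumrB.
by apply: eq_bigr => b _; rewrite mulrBl.
Qed.

Lemma ip_ge0 X : 0 <= ip X X.
Proof. by apply: sumr_ge0 => a _; apply: sumr_ge0 => b _; rewrite -expr2 sqr_ge0. Qed.

Lemma ip_eq0 X a b : ip X X = 0 -> X a b = 0.
Proof.
move=> X0; have Xa : \sum_b X a b * X a b = 0.
  apply: (psumr_eq0P _ X0) => // i _.
  by apply: sumr_ge0 => j _; rewrite -expr2 sqr_ge0.
have : X a b * X a b = 0.
  by apply: (psumr_eq0P _ Xa) => // i _; rewrite -expr2 sqr_ge0.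
by move/eqP; rewrite mulf_eq0 orbb => /eqP.
Qed.

(** The matrices, flattened to the rows of [A], satisfy [A A^T = 1], which bounds the number of rows
    by the number of columns. *)
Lemma orthonormal_bound k (B : nat -> I -> I -> R) :
  (forall i j, (i < k)%N -> (j < k)%N -> ip (B i) (B j) = (i == j)%:R) ->
  (k <= #|{: I * I}|)%N.
Proof.
move=> on.
pose A : 'M[R]_(k, #|{: I * I}|) := \matrix_(i, j) B i (enum_val j).1 (enum_val j).2.
suff AA : A *m A^T = 1%:M by apply: mulmx1_min AA.
apply/matrixP=> i j; rewrite !mxE.
under eq_bigr => l _ do rewrite !mxE.
rewrite (sum_enum_val (fun p : I * I => B i p.1 p.2 * B j p.1 p.2)) sum_pair.
by rewrite -[LHS]/(ip (B i) (B j)) on.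
Qed.

Lemma sum_delta_l (F : I -> R) a : \sum_b (a == b)%:R * F b = F a.
Proof.
rewrite -[RHS](sum_delta F); apply: eq_bigr => b _.
by rewrite mulrC eq_sym.
Qed.

End Inner.

(** Transposition on words: it makes inner products of words expressible as sums of entries of
    words. *)
Fixpoint wtr (w : word) : word :=
  match w with
  | WJ => WJ
  | WMul w1 w2 => WMul (wtr w2) (wtr w1)
  | WI w => WI (wtr w)
  | WA w => WA (wtr w)
  end.

Lemma ev_wtr (G : graph) w (a b : G) : ev (wtr w) a b = ev w b a.
Proof.
elim: w a b => [|w1 IH1 w2 IH2|w IH|w IH] a b //=.
- by apply: eq_bigr => c _; rewrite IH1 IH2 mulnC.
- by rewrite IH eq_sym.
- by rewrite IH edge_sym.
Qed.

Section Span.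
Variables (R : realType) (G H : sgraph).

Definition lincomb (K : sgraph) (s : seq (R * word)) (a b : K) : R :=
  \sum_(t <- s) t.1 * evR R t.2 a b.

(** One formal combination of words, evaluated over both graphs. This is a relation because
    different combinations may agree over [G]; that [Y] is nevertheless determined by [X] follows
    from [span_ip], once the sums of entries agree. *)
Definition span_pair (X : G -> G -> R) (Y : H -> H -> R) : Prop :=
  exists s, X =2 lincomb s /\ Y =2 lincomb s.

Lemma lincomb_map (K : sgraph) f (op : K -> K -> R) s (a b : K) :
  (forall w, evR R (f w) a b = op a b * evR R w a b) ->
  lincomb [seq (t.1, f t.2) | t <- s] a b = op a b * lincomb s a b.
Proof.
move=> fE; rewrite /lincomb big_map mulr_sumr; apply: eq_bigr => t _ /=.
by rewrite fE mulrCA.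
Qed.

Lemma span_I X Y : span_pair X Y ->
  span_pair (fun a b => (a == b)%:R * X a b) (fun a b => (a == b)%:R * Y a b).
Proof.
case=> s [Xs Ys]; exists [seq (t.1, WI t.2) | t <- s].
by split=> a b; rewrite (@lincomb_map _ _ (fun a b => (a == b)%:R)) ?Xs ?Ys // => w;
  rewrite /evR /= natrM.
Qed.

Lemma span_A X Y : span_pair X Y ->
  span_pair (fun a b => (edge a b)%:R * X a b) (fun a b => (edge a b)%:R * Y a b).
Proof.
case=> s [Xs Ys]; exists [seq (t.1, WA t.2) | t <- s].
by split=> a b; rewrite (@lincomb_map _ _ (fun a b => (edge a b)%:R)) ?Xs ?Ys // => w;
  rewrite /evR /= natrM.
Qed.

Lemma span_tr X Y : span_pair X Y -> span_pair (fun a b => X b a) (fun a b => Y b a).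
Proof.
case=> s [Xs Ys]; exists [seq (t.1, wtr t.2) | t <- s].
by split=> a b; rewrite ?Xs ?Ys /lincomb big_map; apply: eq_bigr => t _;
  rewrite /evR ev_wtr.
Qed.

Lemma lincomb_mul (K : sgraph) s s' (a b : K) :
  lincomb [seq (t.1 * t'.1, WMul t.2 t'.2) | t <- s, t' <- s'] a b =
  \sum_c lincomb s a c * lincomb s' c b.
Proof.
rewrite /lincomb big_allpairs_dep /=.
under [RHS]eq_bigr => c _ do rewrite mulr_suml.
rewrite [RHS]exchange_big; apply: eq_bigr => t _.
under [RHS]eq_bigr => c _ do rewrite mulr_sumr.
rewrite [RHS]exchange_big; apply: eq_bigr => t' _.
rewrite /evR /= natr_sum mulr_sumr; apply: eq_bigr => c _.
by rewrite natrM; ring.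
Qed.

Lemma span_mul X Y X' Y' : span_pair X Y -> span_pair X' Y' ->
  span_pair (fun a b => \sum_c X a c * X' c b) (fun a b => \sum_c Y a c * Y' c b).
Proof.
case=> s [Xs Ys] [s' [Xs' Ys']].
exists [seq (t.1 * t'.1, WMul t.2 t'.2) | t <- s, t' <- s'].
by split=> a b; rewrite lincomb_mul; apply: eq_bigr => c _; rewrite ?Xs ?Ys ?Xs' ?Ys'.
Qed.

Lemma span_J : span_pair (fun _ _ => 1) (fun _ _ => 1).
Proof.
by exists [:: (1, WJ)]; split=> a b; rewrite /lincomb big_seq1 /evR /= mul1r.
Qed.

Lemma span_delta : span_pair (fun a b => (a == b)%:R) (fun a b => (a == b)%:R).
Proof.
case: (span_I span_J) => s [Xs Ys]; exists s.
by split=> a b; rewrite -?Xs -?Ys mulr1.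
Qed.

Lemma span_scale c X Y : span_pair X Y ->
  span_pair (fun a b => c * X a b) (fun a b => c * Y a b).
Proof.
case=> s [Xs Ys]; exists [seq (c * t.1, t.2) | t <- s].
by split=> a b; rewrite ?Xs ?Ys /lincomb big_map mulr_sumr; apply: eq_bigr => t _;
  rewrite /= mulrA.
Qed.

Lemma span_add X Y X' Y' : span_pair X Y -> span_pair X' Y' ->
  span_pair (fun a b => X a b + X' a b) (fun a b => Y a b + Y' a b).
Proof.
case=> s [Xs Ys] [s' [Xs' Ys']]; exists (s ++ s').
by split=> a b; rewrite /lincomb big_cat ?Xs ?Xs' ?Ys ?Ys'.
Qed.

Lemma span_sub_sum k (c : nat -> R) X Y (B : nat -> G -> G -> R) (C : nat -> H -> H -> R) :
  span_pair X Y -> (forall i, (i < k)%N -> span_pair (B i) (C i)) ->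
  span_pair (fun a b => X a b - \sum_(i < k) c i * B i a b)
            (fun a b => Y a b - \sum_(i < k) c i * C i a b).
Proof.
move=> sXY; elim: k => [|k IH] sBC.
  by case: sXY => s [Xs Ys]; exists s; split=> a b; rewrite big_ord0 subr0.
have IH' := IH (fun i ik => sBC i (ltnW ik)).
case: (span_add IH' (span_scale (- c k) (sBC k (ltnSn k)))) => s [Xs Ys].
by exists s; split=> a b; rewrite -?Xs -?Ys big_ord_recr /=; ring.
Qed.

Hypothesis soeGH : forall w, soe G w = soe H w.

Lemma span_soe X Y : span_pair X Y ->
  \sum_a \sum_b X a b = \sum_a \sum_b Y a b.
Proof.
have E (K : sgraph) s : \sum_(a : K) \sum_b lincomb s a b = \sum_(t <- s) t.1 * (soe K t.2)%:R.
  rewrite /soe; under [RHS]eq_bigr => t _ do rewrite natr_sum mulr_sumr.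
  rewrite [RHS]exchange_big; apply: eq_bigr => a _.
  under [RHS]eq_bigr => t _ do rewrite natr_sum mulr_sumr.
  by rewrite [RHS]exchange_big; apply: eq_bigr => b _.
case=> s [Xs Ys].
under eq_bigr => a _ do under eq_bigr => b _ do rewrite Xs.
under [RHS]eq_bigr => a _ do under eq_bigr => b _ do rewrite Ys.
by rewrite !E; apply: eq_bigr => t _; rewrite soeGH.
Qed.

(* [tr X X'^T] is the sum of the entries of the Schur product of [X X'^T] with
   the identity. *)
Lemma span_ip X Y X' Y' : span_pair X Y -> span_pair X' Y' -> ip X X' = ip Y Y'.
Proof.
move=> sXY sXY'; have := span_soe (span_I (span_mul sXY (span_tr sXY'))).
by under eq_bigr => a _ do rewrite sum_delta_l;
  under [RHS]eq_bigr => a _ do rewrite sum_delta_l.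
Qed.

(** Orthonormality is demanded over [G] only; by [span_ip] the [C i] inherit it when the sums of
    entries agree. *)
Definition orthonormal k (B : nat -> G -> G -> R) (C : nat -> H -> H -> R) : Prop :=
  (forall i, (i < k)%N -> span_pair (B i) (C i)) /\
  (forall i j, (i < k)%N -> (j < k)%N -> ip (B i) (B j) = (i == j)%:R).

Lemma orthonormal_extend k B C X Y : orthonormal k B C -> span_pair X Y ->
  (forall i, (i < k)%N -> ip X (B i) = 0) -> ip X X != 0 ->
  exists B' C', orthonormal k.+1 B' C'.
Proof.
move=> [sBC on] sXY X0 Xn0; pose c := (Num.sqrt (ip X X))^-1.
pose X' a b := c * X a b.
exists (fun i => if i == k then X' else B i).
exists (fun i => if i == k then (fun a b => c * Y a b) else C i).
have ipc Z : ip X' Z = c * ip X Z.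
  rewrite /ip mulr_sumr; apply: eq_bigr => a _; rewrite mulr_sumr.
  by apply: eq_bigr => b _; rewrite mulrA.
have X'B i : (i < k)%N -> ip X' (B i) = 0 by move=> ik; rewrite ipc X0 ?mulr0.
have X'X' : ip X' X' = 1.
  rewrite ipc ipC ipc mulrA -expr2 exprVn sqr_sqrtr ?ip_ge0 //.
  by rewrite mulVf.
have lt_k i : (i < k.+1)%N -> i != k -> (i < k)%N.
  by rewrite ltnS leq_eqVlt => /orP[/eqP->|//]; rewrite eqxx.
split=> [i ik|i j ik jk].
  by have [_|nik] := eqVneq i k; [apply: span_scale | apply/sBC/lt_k].
have [ei|nik] := eqVneq i k; have [ej|njk] := eqVneq j k.
- by rewrite ei ej eqxx.
- by rewrite X'B ?lt_k // ei eq_sym (negPf njk).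
- by rewrite ipC X'B ?lt_k // ej (negPf nik).
- by apply: on; apply: lt_k.
Qed.

Definition orthonormal_basis k B C : Prop :=
  orthonormal k B C /\
  forall X Y, span_pair X Y -> (forall i, (i < k)%N -> ip X (B i) = 0) -> ip X X = 0.

(** Otherwise every orthonormal system could be extended, beyond the bound given by the number of
    matrix entries. *)
Lemma orthonormal_basis_exists : exists k B C, orthonormal_basis k B C.
Proof.
apply: boolp.contrapT => nb.
have all k : exists B C, orthonormal k B C.
  elim: k => [|k [B [C on]]].
    by exists (fun _ _ _ => 0), (fun _ _ _ => 0); split.
  apply: boolp.contrapT => next; apply: nb; exists k, B, C; split=> // X Y sXY X0.
  apply/eqP; apply: boolp.contrapT => /negP Xn0; apply: next.
  exact: orthonormal_extend on sXY X0 Xn0.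
have [B [C [_ on]]] := all #|{: G * G}|.+1.
by have := orthonormal_bound on; rewrite ltnn.
Qed.

Section Basis.
Variables (k : nat) (B : nat -> G -> G -> R) (C : nat -> H -> H -> R).
Hypothesis basis : orthonormal_basis k B C.

Let sBC i : (i < k)%N -> span_pair (B i) (C i).
Proof. by case: basis => [[h _] _]; apply: h. Qed.

(** The remainder of the expansion is a pair of the span that is orthogonal to the basis over [G],
    hence of norm 0 there; [span_ip] gives norm 0 over [H] too. So the same coefficients serve both
    graphs. *)
Lemma basis_expand X Y : span_pair X Y ->
  (forall a b, X a b = \sum_(i < k) ip X (B i) * B i a b) /\
  (forall a b, Y a b = \sum_(i < k) ip X (B i) * C i a b).
Proof.
move=> sXY; have [[_ on] max] := basis.
have sR := span_sub_sum (fun i => ip X (B i)) sXY sBC.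
have R0 : ip (fun a b => X a b - \sum_(i < k) ip X (B i) * B i a b)
               (fun a b => X a b - \sum_(i < k) ip X (B i) * B i a b) = 0.
  apply: max sR _ => j jk; rewrite (@ip_linearl _ _ k (fun i => ip X (B i)) X (B j) B) (bigD1 (Ordinal jk)) //= on // eqxx mulr1.
  rewrite big1 ?addr0 ?subrr // => i ij; rewrite on // (_ : (i == j :> nat) = false) ?mulr0 //.
  exact: negPf ij.
split=> a b; apply/eqP; rewrite -subr_eq0; apply/eqP.
  exact: (ip_eq0 a b R0).
by rewrite (span_ip sR sR) in R0; apply: (ip_eq0 a b R0).
Qed.

(** For an operator that sends [B i] to [X i], with adjoint sending [B j] to [X' j]: applying the
    operator to the [G] side of the tensor of all [B i (x) C i] equals applying the adjoint, in its
    form over [H], to the [H] side. The constraints on [coupling] are instances. *)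
Lemma basis_transfer (X X' : nat -> G -> G -> R) (Y' : nat -> H -> H -> R) g g' h h' :
  (forall i, (i < k)%N -> exists Y, span_pair (X i) Y) ->
  (forall j, (j < k)%N -> span_pair (X' j) (Y' j)) ->
  (forall i j, (i < k)%N -> (j < k)%N -> ip (X i) (B j) = ip (X' j) (B i)) ->
  \sum_(i < k) X i g g' * C i h h' = \sum_(j < k) B j g g' * Y' j h h'.
Proof.
move=> sX sX' adj.
transitivity (\sum_(i < k) \sum_(j < k) ip (X i) (B j) * B j g g' * C i h h').
  apply: eq_bigr => i _; have [Y sXY] := sX i (ltn_ord i).
  by have [-> _] := basis_expand sXY; rewrite mulr_suml.
rewrite exchange_big; apply: eq_bigr => j _.
have [_ ->] := basis_expand (sX' j (ltn_ord j)).
by rewrite mulr_sumr; apply: eq_bigr => i _; rewrite adj //; ring.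
Qed.

Definition coupling (a b : G * H) : R := \sum_(i < k) B i a.1 b.1 * C i a.2 b.2.

(** Transposition is its own adjoint; moved across the tensor, it transposes the [C i] instead of
    the [B i]. *)
Lemma coupling_sym a b : coupling a b = coupling b a.
Proof.
transitivity (\sum_(i < k) B i b.1 a.1 * (fun h h' => C i h' h) a.2 b.2) => //=.
rewrite -(@basis_transfer (fun i g g' => B i g' g) (fun i g g' => B i g' g)
  (fun i h h' => C i h' h)) //.
- by move=> i /sBC/span_tr; exists (fun h h' => C i h' h).
- by move=> i /sBC/span_tr.
- by move=> i j _ _; rewrite ipC /ip exchange_big.
Qed.

Lemma coupling_I g h g' h' : (g == g') != (h == h') -> coupling (g, h) (g', h') = 0.
Proof.
move=> ne.
have : (g == g')%:R * coupling (g, h) (g', h') = (h == h')%:R * coupling (g, h) (g', h').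
  rewrite /coupling !mulr_sumr /=.
  under eq_bigr => i _ do rewrite mulrA.
  under [RHS]eq_bigr => i _ do rewrite mulrCA.
  apply: (@basis_transfer (fun i a b => (a == b)%:R * B i a b)
     (fun i a b => (a == b)%:R * B i a b) (fun i a b => (a == b)%:R * C i a b)).
  - by move=> i /sBC/span_I; exists (fun a b => (a == b)%:R * C i a b).
  - by move=> i /sBC/span_I.
  - move=> i j _ _; rewrite ipC; apply: eq_bigr => a _; apply: eq_bigr => b _.
    by ring.
by case: (g == g') ne; case: (h == h') => // _; rewrite mul0r mul1r.
Qed.

Lemma coupling_A g h g' h' : edge g g' != edge h h' -> coupling (g, h) (g', h') = 0.
Proof.
move=> ne.
have : (edge g g')%:R * coupling (g, h) (g', h') = (edge h h')%:R * coupling (g, h) (g', h').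
  rewrite /coupling !mulr_sumr /=.
  under eq_bigr => i _ do rewrite mulrA.
  under [RHS]eq_bigr => i _ do rewrite mulrCA.
  apply: (@basis_transfer (fun i a b => (edge a b)%:R * B i a b)
     (fun i a b => (edge a b)%:R * B i a b) (fun i a b => (edge a b)%:R * C i a b)).
  - by move=> i /sBC/span_A; exists (fun a b => (edge a b)%:R * C i a b).
  - by move=> i /sBC/span_A.
  - move=> i j _ _; rewrite ipC; apply: eq_bigr => a _; apply: eq_bigr => b _.
    by ring.
by case: (edge g g') ne; case: (edge h h') => // _; rewrite mul0r mul1r.
Qed.

(** Right multiplication by the all-ones matrix is self-adjoint and can be moved from the [G] side
    to the [H] side. *)
Lemma coupling_J g h g' h' :
  \sum_x coupling (g, h) (g', x) = \sum_x coupling (g, h) (x, h').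
Proof.
rewrite /coupling exchange_big [RHS]exchange_big /=; symmetry.
transitivity (\sum_(i < k) (\sum_c B i g c * 1) * C i h h').
  by apply: eq_bigr => i _; rewrite mulr_suml; apply: eq_bigr => c _; rewrite mulr1.
rewrite (@basis_transfer (fun i a _ => \sum_c B i a c * 1)
  (fun i a _ => \sum_c B i a c * 1) (fun i a _ => \sum_c C i a c * 1) g g' h h').
- by apply: eq_bigr => i _; rewrite mulr_sumr; apply: eq_bigr => c _; rewrite mulr1.
- by move=> i /sBC/span_mul/(_ span_J); exists (fun a _ => \sum_c C i a c * 1).
- by move=> i /sBC/span_mul/(_ span_J).
- move=> i j _ _; rewrite ipC; apply: eq_bigr => a _.
  by rewrite -mulr_suml -mulr_sumr; congr (_ * _); apply: eq_bigr => b _; rewrite mulr1.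
Qed.

(** By [coupling_J] the sum does not depend on [g']; for [g' = g] only the term [x = h] survives. *)
Lemma coupling_row g h g' : \sum_x coupling (g, h) (g', x) = coupling (g, h) (g, h).
Proof.
rewrite (coupling_J g h g' h) -(coupling_J g h g h) (bigD1 h) //= big1 ?addr0 //.
by move=> x xh; apply: coupling_I; rewrite eqxx [h == x]eq_sym (negPf xh).
Qed.

Lemma trace_basis i : (i < k)%N -> \sum_h C i h h = \sum_g B i g g.
Proof.
move=> ik; have := span_ip span_delta (sBC ik).
rewrite /ip; under eq_bigr => a _ do rewrite sum_delta_l.
by under [X in _ = X -> _]eq_bigr => a _ do rewrite sum_delta_l.
Qed.

Lemma ip_delta (X : G -> G -> R) : ip (fun a b => (a == b)%:R) X = \sum_a X a a.
Proof. by apply: eq_bigr => a _; rewrite sum_delta_l. Qed.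

(** The sum has the coefficients [tr (C i) = tr (B i)], which are the coefficients of the identity
    in the basis; so it is a diagonal entry of the identity. *)
Lemma coupling_row1 g : \sum_h coupling (g, h) (g, h) = 1.
Proof.
have [E _] := basis_expand span_delta; have := E g g; rewrite eqxx => E1.
rewrite -[RHS]/(true%:R) E1.
rewrite exchange_big; apply: eq_bigr => i _ /=; rewrite -mulr_sumr ip_delta.
by rewrite trace_basis // mulrC.
Qed.

Lemma coupling_col1 h : \sum_g coupling (g, h) (g, h) = 1.
Proof.
have [_ E] := basis_expand span_delta; have := E h h; rewrite eqxx => E1.
rewrite -[RHS]/(true%:R) E1.
by rewrite exchange_big; apply: eq_bigr => i _ /=; rewrite -mulr_suml ip_delta.
Qed.

(** [basis_transfer] for left multiplication by [B i], whose adjoint is left multiplication by the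
    transpose. *)
Let basis_mul i (a : G) (c : H) g' h' : (i < k)%N ->
  \sum_x B i a x * coupling (x, c) (g', h') =
  \sum_x C i x c * coupling (a, x) (g', h').
Proof.
move=> ik.
transitivity (\sum_(j < k) (\sum_x B i a x * B j x g') * C j c h').
  under eq_bigr => x _ do rewrite mulr_sumr.
  rewrite exchange_big; apply: eq_bigr => j _; rewrite mulr_suml.
  by apply: eq_bigr => x _; rewrite mulrA.
rewrite (@basis_transfer (fun j a b => \sum_x B i a x * B j x b)
  (fun j a b => \sum_x B i x a * B j x b) (fun j a b => \sum_x C i x a * C j x b)).
- under [RHS]eq_bigr => x _ do rewrite mulr_sumr.
  rewrite exchange_big; apply: eq_bigr => j _; rewrite mulr_sumr.
  by apply: eq_bigr => x _ /=; ring.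
- move=> j jk; exists (fun a b => \sum_x C i a x * C j x b).
  by apply: span_mul; apply: sBC.
- by move=> j jk; apply: (span_mul (span_tr (sBC ik))); apply: sBC.
- move=> j l _ _; rewrite /ip.
  transitivity (\sum_y \sum_b \sum_x B i y x * B j x b * B l y b).
    by apply: eq_bigr => y _; apply: eq_bigr => b _; rewrite mulr_suml.
  transitivity (\sum_x \sum_b \sum_y B i y x * B j x b * B l y b).
    under eq_bigr => y _ do rewrite exchange_big.
    rewrite exchange_big; apply: eq_bigr => x _.
    by rewrite exchange_big.
  apply: eq_bigr => x _; apply: eq_bigr => b _; rewrite mulr_suml.
  by apply: eq_bigr => y _; ring.
Qed.

(** [psd_of_square] with [K i = 1 (x) C i]. In the product of [coupling] with itself, [basis_mul]
    replaces the factor [B i] over [G] by the transpose of [C i] over [H]. The required combination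
    of the [K i] is the expansion of the identity. *)
Lemma coupling_psd z : 0 <= qform coupling z.
Proof.
pose K i (a b : G * H) : R := (a.1 == b.1)%:R * C i a.2 b.2.
have KK l g h x y : \sum_d K l (g, h) d * K l (x, y) d =
    (g == x)%:R * \sum_c C l h c * C l y c.
  rewrite sum_pair.
  transitivity (\sum_x' (g == x')%:R * ((x == x')%:R * \sum_c C l h c * C l y c)).
    apply: eq_bigr => x' _; rewrite !mulr_sumr; apply: eq_bigr => c _.
    by rewrite /K /=; ring.
  by rewrite sum_delta_l [x == g]eq_sym.
rewrite -fun_mx_form.
apply: (@psd_of_square _ _ k _ (fun i => fun_mx (K i))
   (fun i => ip (fun a b => (a == b)%:R) (B i))).
- by apply/matrixP=> i j; rewrite !mxE coupling_sym.
- rewrite fun_mx_mul mulmx_suml.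
  have tr i : (fun_mx (K i))^T = fun_mx (fun a b => K i b a) by apply/matrixP=> ? ?; rewrite !mxE.
  under eq_bigr => i _ do rewrite tr !fun_mx_mul.
  apply/matrixP=> i j; rewrite mxE summxE.
  under [RHS]eq_bigr => l _ do rewrite mxE.
  move: (enum_val i) (enum_val j) => [g h] [g' h'].
  rewrite sum_pair.
  transitivity (\sum_(l < k) \sum_c C l h c * \sum_x B l g x * coupling (x, c) (g', h')).
    transitivity (\sum_x \sum_c \sum_(l < k) C l h c * (B l g x * coupling (x, c) (g', h'))).
      apply: eq_bigr => x _; apply: eq_bigr => c _; rewrite mulr_suml.
      by apply: eq_bigr => l _ /=; ring.
    rewrite exchange_big; under eq_bigr => c _ do rewrite exchange_big.
    rewrite exchange_big; apply: eq_bigr => l _; apply: eq_bigr => c _.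
    by rewrite mulr_sumr.
  apply: eq_bigr => l _; under eq_bigr => c _ do rewrite basis_mul //.
  rewrite sum_pair.
  transitivity (\sum_x C l h x * \sum_y C l y x * coupling (g, y) (g', h')) => //.
  transitivity (\sum_x \sum_y (g == x)%:R *
     \sum_c C l h c * C l y c * coupling (g, y) (g', h')).
    under [RHS]eq_bigr => x _ do rewrite -mulr_sumr.
    rewrite sum_delta_l exchange_big; apply: eq_bigr => c _; rewrite mulr_sumr.
    by apply: eq_bigr => y _; rewrite mulrA.
  apply: eq_bigr => x _; apply: eq_bigr => y _.
  rewrite KK; have [<-|_] := eqVneq g x; last by rewrite !mul0r.
  by rewrite !mul1r mulr_suml.
- apply/matrixP=> i j; rewrite summxE mxE.
  under eq_bigr => l _ do rewrite !mxE /K.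
  have -> : (i == j) = (enum_val i == enum_val j :> G * H) by rewrite (inj_eq enum_val_inj).
  move: (enum_val i) (enum_val j) => [g h] [g' h'] /=.
  have [_ E] := basis_expand span_delta.
  under eq_bigr => l _ do rewrite mulrCA.
  by rewrite -mulr_sumr -E xpair_eqE -natrM mulnb.
Qed.

End Basis.

End Span.

Section SetExtension.
Variables (R : realType) (T : finType) (p : T -> T -> R).
Hypothesis p_sym : forall a b, p a b = p b a.

(** Turns the kernel [p] into a function of sets; by symmetry of [p] the order in which [pick] finds
    two elements does not matter. *)
Definition pair_value (I : {set T}) : R :=
  if [pick a in I] is Some a then
    if [pick b in I :\ a] is Some b then p a b else p a a
  else 1.

Lemma pair_value0 : pair_value set0 = 1.
Proof. by rewrite /pair_value; case: pickP => // a; rewrite inE. Qed.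

Lemma pair_value2 a b : pair_value [set a; b] = p a b.
Proof.
rewrite /pair_value; case: pickP => [c|/(_ a)]; last by rewrite !inE eqxx.
case/set2P=> ->; case: pickP => [d|h].
- by rewrite !inE => /andP[/negPf-> /eqP->].
- by have := h b; rewrite !inE eqxx orbT andbT => /negbFE/eqP->.
- by rewrite !inE p_sym => /andP[/negPf db]; rewrite db orbF => /eqP->.
- by have := h a; rewrite !inE eqxx andbT => /negbFE/eqP->.
Qed.

Lemma pair_value1 a : pair_value [set a] = p a a.
Proof. by rewrite -(setUid [set a]) pair_value2. Qed.

End SetExtension.

Lemma soe_lasserre1 (R : realType) (G H : sgraph) :
  (forall w, soe G w = soe H w) -> lasserre1 R G H.
Proof.
move=> soeGH; have [k [B [C basis]]] := orthonormal_basis_exists R G H.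
pose p := coupling k B C.
have p_sym a b : p a b = p b a by apply: (coupling_sym soeGH basis).
have p_eq g h g' h' : (g == g') != (h == h') -> p (g, h) (g', h') = 0.
  exact: (coupling_I soeGH basis).
have p_edge g h g' h' : edge g g' != edge h h' -> p (g, h) (g', h') = 0.
  exact: (coupling_A soeGH basis).
have p_row g h g' : \sum_x p (g, h) (g', x) = p (g, h) (g, h).
  exact: (coupling_row soeGH basis).
have p_row1 g : \sum_h p (g, h) (g, h) = 1 by exact: (coupling_row1 soeGH basis).
have p_col1 h : \sum_g p (g, h) (g, h) = 1 by exact: (coupling_col1 soeGH basis).
have p_psd z : 0 <= qform p z by exact: (coupling_psd soeGH basis).
exists (pair_value p); split.
- apply/psdmx_moment => z.
  pose zT (t : G * H) := z (Some t).
  have E : qform (fun a b => pair_value p (small_set a :|: small_set b)) z =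
      z None ^+ 2 + 2 * z None * (\sum_t zT t * p t t) + qform p zT.
    rewrite /qform sum_option.
    have -> : \sum_b z None * z b * pair_value p (small_set None :|: small_set b) =
        z None ^+ 2 + z None * \sum_t zT t * p t t.
      rewrite sum_option /= set0U pair_value0 mulr1 mulr_sumr; congr (_ + _).
      by apply: eq_bigr => t _; rewrite set0U pair_value1 // mulrA.
    have -> : \sum_t \sum_b z (Some t) * z b * pair_value p (small_set (Some t) :|: small_set b) =
        z None * \sum_t zT t * p t t + \sum_a \sum_b zT a * zT b * p a b.
      rewrite mulr_sumr -big_split; apply: eq_bigr => t _.
      rewrite sum_option /= setU0 pair_value1 //; congr (_ + _); first by rewrite /zT; ring.
      by apply: eq_bigr => t' _; rewrite pair_value2.
    by ring.
  (* Without vertices in [G] there are no pairs, and the form reduces to the square of [z None]. *)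
  rewrite E; case: (pickP G) => [g0 _|G0]; last first.
    rewrite /qform !big1 ?mulr0 ?addr0 ?sqr_ge0 //.
      by case=> g h; have := G0 g.
    by case=> g h; have := G0 g.
  (* By [p_row] the row of the empty set is the sum of the rows of the pairs [(g0, h)], so the
     coordinate [z None] can be distributed over these pairs, leaving a form in [p] alone. *)
  pose u (t : G * H) := zT t + z None * (t.1 == g0)%:R.
  have rowE (F : G * H -> R) : \sum_t (t.1 == g0)%:R * F t = \sum_h F (g0, h).
    rewrite sum_pair exchange_big; apply: eq_bigr => h _ /=.
    by rewrite -[RHS](sum_delta (fun g => F (g, h))); apply: eq_bigr => g _; rewrite mulrC.
  have p_row' g h g' : \sum_x p (g', x) (g, h) = p (g, h) (g, h).
    by under eq_bigr => x _ do rewrite p_sym; exact: p_row.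
  suff -> : z None ^+ 2 + 2 * z None * (\sum_t zT t * p t t) + qform p zT = qform p u.
    exact: p_psd.
  have U1 : \sum_a \sum_b zT a * (b.1 == g0)%:R * p a b = \sum_t zT t * p t t.
    apply: eq_bigr => -[g h] _; rewrite -(p_row g h g0) mulr_sumr -(rowE (fun b => zT (g, h) * p (g, h) b)).
    by apply: eq_bigr => b _; ring.
  have U2 : \sum_a \sum_b (a.1 == g0)%:R * zT b * p a b = \sum_t zT t * p t t.
    rewrite exchange_big -U1; apply: eq_bigr => a _; apply: eq_bigr => b _.
    by rewrite p_sym; ring.
  have U3 : \sum_(a : G * H) \sum_(b : G * H) (a.1 == g0)%:R * (b.1 == g0)%:R * p a b = 1.
    transitivity (\sum_(a : G * H) (a.1 == g0)%:R * p a a).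
      apply: eq_bigr => -[g h] _; rewrite -(p_row g h g0) -(rowE (p (g, h))) mulr_sumr.
      by apply: eq_bigr => b _; ring.
    by rewrite rowE; apply: p_row1.
  transitivity (z None ^+ 2 * 1 + z None * (\sum_t zT t * p t t)
     + z None * (\sum_t zT t * p t t) + qform p zT); first by ring.
  rewrite -{1}U3 -{1}U1 -U2 /qform !mulr_sumr -!big_split; apply: eq_bigr => a _ /=.
  rewrite !mulr_sumr -!big_split; apply: eq_bigr => b _ /=.
  by rewrite /u; ring.
- by move=> g; rewrite pair_value0 -(p_row1 g); apply: eq_bigr => h _; rewrite pair_value1.
- by move=> h; rewrite pair_value0 -(p_col1 h); apply: eq_bigr => g _; rewrite pair_value1.
- move=> I; rewrite inE => I2.
  case/forallPn=> -[g h]; rewrite negb_imply => /andP[gI].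
  case/forallPn=> -[g' h']; rewrite negb_imply => /andP[gI' /= ne].
  (* A single pair never violates the conditions, as both graphs are loopless; so the violation
     comes from two distinct pairs, which exhaust [I]. *)
  have ghne : (g, h) != (g', h').
    by apply: contraNneq ne => -[<- <-]; rewrite !eqxx !edge_irrefl.
  have -> : I = [set (g, h); (g', h')].
    apply/esym/eqP; rewrite eqEcard cards2 ghne I2 andbT.
    by apply/subsetP=> x /set2P[] ->.
  rewrite pair_value2 //; move: ne; rewrite negb_and => /orP[/p_eq|/p_edge]; exact.
- exact: pair_value0.
Qed.

Theorem theorem1p5 (R : realType) (G H : sgraph) :
  lasserre1 R G H <-> hom_equiv outerplanar G H.
Proof.
rewrite hom_equiv_outerplanarE; split=> [L w|]; last exact: soe_lasserre1.
exact: lasserre1_soe L.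
Qed.
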